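(* Let $\mathbb{Z}^2\curvearrowright X$ be a free Borel action of $\mathbb{Z}^2$ on a Polish space $X$. Then there is a Borel lining for the Schreier graph of the action on $X$ (with respect to the standard generators of $\mathbb{Z}^2$).
   Context: The standard generating set of $\mathbb{Z}^2$ is $S=\{\pm e_1,\pm e_2\}$ with $e_1=(1,0)$, $e_2=(0,1)$. The Schreier graph of an action $\mathbb{Z}^2\curvearrowright X$ has vertex set $X$ and edges $(x,y)$ with $y=s\cdot x$ for some $s\in S$. A line section is a subgraph $G$ of the Schreier graph in which each vertex of $G$ has degree $2$; the connected components of $G$ are called $G$-lines. A line section $G$ is single if for each $x\in X$ the intersection of $G$ with the orbit of $x$ is a nonempty single $G$-line. A lining is a single line section whose vertex set is all of $X$ (so on each orbit it is a bi-infinite Hamiltonian path of the Schreier graph). A line section $G$ is Borel if for each $e\in S$ the set $\{x\in X: (x,e\cdot x)\in G\}$ is Borel. *)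

(* Defs.v *)
(* MathComp-Analysis *)
From mathcomp Require Import all_boot all_order all_algebra.
From mathcomp Require Import all_classical all_reals.
From mathcomp Require Import topology measure.
From Stdlib Require Import Relation_Operators.

Set Implicit Arguments.
Unset Strict Implicit.
Unset Printing Implicit Defensive.

Import Order.TTheory GRing.Theory Num.Theory.

Local Open Scope classical_set_scope.
Local Open Scope ring_scope.
Local Open Scope card_scope.

Section Polish.
Context (R : realType) (X : topologicalType).

Definition is_metric (d : X -> X -> R) : Prop :=
  [/\ forall x y, 0 <= d x y,
      forall x y, d x y = 0 <-> x = y,
      forall x y, d x y = d y x &
      forall x y z, d x z <= d x y + d y z].

Definition induces_topology (d : X -> X -> R) : Prop :=
  forall (x : X) (A : set X),
    nbhs x A <-> exists2 e : R, 0 < e & [set y | d x y < e] `<=` A.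

Definition complete_metric (d : X -> X -> R) : Prop :=
  forall u : nat -> X,
    (forall e : R, 0 < e -> exists N : nat,
        forall m n : nat, (N <= m)%N -> (N <= n)%N -> d (u m) (u n) < e) ->
    exists l : X, forall e : R, 0 < e -> exists N : nat,
        forall n : nat, (N <= n)%N -> d (u n) l < e.

(* The metric is not part of the structure, and X may be empty. *)
Definition polish_space : Prop :=
  (exists2 D : set X, countable D & dense D) /\
  (exists d : X -> X -> R,
    [/\ is_metric d, induces_topology d & complete_metric d]).

End Polish.

(* Borel sets are given as a predicate rather than through the library's
   measurableType, which would force the space to be pointed. *)
Definition borel (X : topologicalType) : set (set X) := <<s @open X >>.

Definition borel_map (X Y : topologicalType) (f : X -> Y) : Prop :=
  forall B : set Y, borel B -> borel (f @^-1` B).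

Notation Z2 := (int * int)%type.

Definition e1 : Z2 := (1, 0).
Definition e2 : Z2 := (0, 1).
Definition std_gen : set Z2 := [set e1; - e1; e2; - e2].

Section Actions.
Context (X : topologicalType) (act : Z2 -> X -> X).

Definition is_action : Prop :=
  (forall x, act 0 x = x) /\
  (forall g h x, act (g + h) x = act g (act h x)).

Definition free_action : Prop := forall g x, act g x = x -> g = 0.

(* Joint Borel measurability of Z^2 * X -> X, with Z^2 discrete. *)
Definition borel_action : Prop :=
  borel_map (fun p : discrete_topology Z2 * X => act p.1 p.2).

Definition orbit (x : X) : set X := range (act^~ x).

Definition schreier_edge (x y : X) : Prop := exists2 s, std_gen s & y = act s x.

End Actions.

(* An undirected edge is encoded by both of its orientations; see
   [schreier_subgraph]. *)
Record graph (X : Type) := Graph {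
  vertices : set X;
  edge : X -> X -> Prop
}.

Section LineSections.
Context (X : topologicalType) (act : Z2 -> X -> X).
Implicit Type G : graph X.

Definition schreier_subgraph G : Prop :=
  [/\ forall x y, edge G x y -> vertices G x /\ vertices G y,
      forall x y, edge G x y -> edge G y x &
      forall x y, edge G x y -> schreier_edge act x y].

Definition line_section G : Prop :=
  schreier_subgraph G /\
  (forall x, vertices G x -> [set y | edge G x y] #= `I_2).

(* G-lines are induced subgraphs, as is the intersection of G with an orbit,
   so both are represented by their vertex sets. *)
Definition component G (x : X) : set X := [set y | clos_refl_trans X (edge G) x y].

Definition is_line G (L : set X) : Prop :=
  exists2 x, vertices G x & L = component G x.

Definition single_line_section G : Prop :=
  line_section G /\ (forall x, is_line G (vertices G `&` orbit act x)).

Definition lining G : Prop :=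
  single_line_section G /\ vertices G = setT.

Definition borel_line_section G : Prop :=
  line_section G /\
  (forall e, std_gen e -> borel [set x | edge G x (act e x)]).

End LineSections.

(* Main.v *)
(* On each orbit the lining is an increasing union of finite paths ("pieces"),
   each of which runs through all cells of a union of 16 x 16 blocks that is
   connected and has connected complement.

   Markers. For each n a Borel set of markers is chosen so that markers on one
   orbit are more than 10 r_n apart, and each point is for infinitely many n well
   inside the square of side about 4 r_n around some marker. Indeed a bounded
   number of separated sets suffices to come r_n-close to every point, and the
   first index that works infinitely often is constant on orbits.

   Growth. At stage n the square around a marker, together with the clusters of
   earlier pieces that it meets, is enlarged and filled to a region that contains
   each earlier piece with some margin or avoids it with some margin. A
   Hamiltonian path of the region that contains the earlier pieces inside it as
   subpaths, extended at both ends, becomes a new piece. As r_n grows fast, there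
   is enough room between different new pieces. Since paths with given properties
   are taken first in an enumeration, the edges form a Borel set.

   Weaving. Away from the earlier pieces the region is cut into 2 x 2 squares, and
   each earlier piece, whose position relative to that grid is arbitrary, gets a
   collar of 2 x 2, 2 x 3 and 3 x 2 rectangles that corrects the parity. The
   boundary of such a rectangle is a cycle through all its cells, so a rectangle
   can be inserted in a path at any edge shared with an adjacent rectangle; the
   earlier pieces are inserted last, each at the edge next to its two ends.
   Everything can be reached because removing from a connected region sets that
   are connected and have connected complement does not disconnect it. *)

Require Import Defs.
From mathcomp Require Import all_boot all_order all_algebra.
From mathcomp Require Import all_classical all_reals.
From mathcomp Require Import topology measure.
From mathcomp Require Import zify.
From Stdlib Require Import Relation_Operators.

Set Implicit Arguments.
Unset Strict Implicit.
Unset Printing Implicit Defensive.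

Import Order.TTheory GRing.Theory Num.Theory.

Local Open Scope ring_scope.

(** * Connectivity in the square grid *)

Definition adj (u v : Z2) : bool := `|u.1 - v.1| + `|u.2 - v.2| == 1.

Definition nearby (k : int) (u v : Z2) : bool :=
  (`|u.1 - v.1| <= k) && (`|u.2 - v.2| <= k).

(** The closure is reflexive everywhere: even a point outside [A] is connected to itself. *)
Definition grid_conn (A : Z2 -> Prop) (u v : Z2) : Prop :=
  clos_refl_trans Z2 (fun x y => [/\ A x, A y & adj x y]) u v.

Definition grid_connected (A : Z2 -> Prop) : Prop :=
  forall u v, A u -> A v -> grid_conn A u v.

Lemma crt_inv (T : Type) (r : T -> T -> Prop) (P : T -> Prop) u v :
  (forall x y, r x y -> P x -> P y) -> clos_refl_trans T r u v -> P u -> P v.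
Proof. by move=> H; elim=> [x y /H|//|x y z _ Hxy _ Hyz /Hxy/Hyz]. Qed.

Lemma crt_map (T U : Type) (r : T -> T -> Prop) (q : U -> U -> Prop)
    (f : T -> U) u v :
  (forall x y, r x y -> clos_refl_trans U q (f x) (f y)) ->
  clos_refl_trans T r u v -> clos_refl_trans U q (f u) (f v).
Proof.
move=> H; elim=> [x y /H//|x|x y z _ Hxy _ Hyz]; first exact: rt_refl.
exact: rt_trans Hxy Hyz.
Qed.

Lemma crt_sym (T : Type) (r : T -> T -> Prop) u v :
  (forall x y, r x y -> r y x) ->
  clos_refl_trans T r u v -> clos_refl_trans T r v u.
Proof.
move=> H; elim=> [x y /H h|x|x y z _ Hxy _ Hyz]; first exact: rt_step.
  exact: rt_refl.
exact: rt_trans Hyz Hxy.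
Qed.

Lemma crt_exit (T : Type) (r : T -> T -> Prop) (P : T -> Prop) u v :
  clos_refl_trans T r u v -> P u -> ~ P v ->
  exists x y, [/\ r x y, P x & ~ P y].
Proof.
move=> uv Pu nPv; apply: contrapT => H; apply: nPv.
apply: crt_inv uv Pu => x y rxy Px; apply: contrapT => nPy.
by apply: H; exists x, y.
Qed.

Lemma adjC u v : adj u v = adj v u.
Proof. by rewrite /adj; lia. Qed.

Lemma near_sym k u v : nearby k u v = nearby k v u.
Proof. by rewrite /nearby; lia. Qed.

Lemma grid_conn_sym A u v : grid_conn A u v -> grid_conn A v u.
Proof. by apply: crt_sym => x y [? ? ?]; split=> //; rewrite adjC. Qed.

Lemma grid_conn_sub (A B : Z2 -> Prop) u v :
  (forall z, A z -> B z) -> grid_conn A u v -> grid_conn B u v.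
Proof.
move=> AB; apply: (crt_map (f := id)) => x y [Ax Ay xy].
by apply: rt_step; split=> //; exact: AB.
Qed.

Lemma grid_connected_ext (A B : Z2 -> Prop) :
  (forall z, A z <-> B z) -> grid_connected A -> grid_connected B.
Proof.
move=> AB cA u v /AB Au /AB Av.
by apply: grid_conn_sub (cA u v Au Av) => z /AB.
Qed.

Lemma grid_conn_hseg (A : Z2 -> Prop) (a b y : int) :
  (forall x, Num.min a b <= x <= Num.max a b -> A (x, y)) ->
  grid_conn A (a, y) (b, y).
Proof.
have up (n : nat) (c : int) : (forall x, c <= x <= c + n%:Z -> A (x, y)) ->
    grid_conn A (c, y) (c + n%:Z, y).
  elim: n => [|n IH] H; first by rewrite addr0; exact: rt_refl.
  apply: rt_trans (IH _) (rt_step _ _ _ _ _); first by move=> x ?; apply: H; lia.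
  by split; [apply: H; lia|apply: H; lia|rewrite /adj /=; lia].
move=> H; have [ab|ba] := leP a b.
  have -> : b = a + (`|b - a|%N)%:Z by lia.
  by apply: up => x ?; apply: H; lia.
apply: grid_conn_sym.
have -> : a = b + (`|a - b|%N)%:Z by lia.
by apply: up => x ?; apply: H; lia.
Qed.

Lemma grid_conn_swap (A : Z2 -> Prop) u v :
  grid_conn (fun z => A (z.2, z.1)) u v -> grid_conn A (u.2, u.1) (v.2, v.1).
Proof.
apply: (crt_map (f := fun z : Z2 => (z.2, z.1))) => x y [Ax Ay xy].
by apply: rt_step; split=> //; rewrite /adj /= addrC.
Qed.

Lemma grid_conn_vseg (A : Z2 -> Prop) (a b x : int) :
  (forall y, Num.min a b <= y <= Num.max a b -> A (x, y)) ->
  grid_conn A (x, a) (x, b).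
Proof.
move=> H; apply: (@grid_conn_swap A (a, x) (b, x)).
exact: grid_conn_hseg.
Qed.

Lemma int_ind_both (P : int -> Prop) :
  P 0 -> (forall n, P n <-> P (n + 1)) -> forall n, P n.
Proof.
move=> P0 PS.
have up (n : nat) : P n%:Z.
  elim: n => [//|n IH]; rewrite (_ : n.+1%:Z = n%:Z + 1); last by lia.
  exact: (PS _).1.
have down (n : nat) : P (- n%:Z).
  elim: n => [|n IH]; first by rewrite oppr0.
  by apply: (PS _).2; rewrite (_ : _ + 1 = - n%:Z) //; lia.
by case=> n; [exact: up|rewrite NegzE; exact: down].
Qed.

Lemma bool_primitive (h : int -> bool) :
  exists S : int -> bool, S 0 = false /\ forall x, S (x + 1) = S x (+) h x.
Proof.
(* Modulo 2 the sum from a negative argument up to 0 needs no sign; [Negz n] stands for -(n + 1). *)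
pose S (x : int) := match x with
  | Posz n => \big[addb/false]_(i < n) h i%:Z
  | Negz n => \big[addb/false]_(i < n.+1) h (Negz i) end.
exists S; split; first by rewrite /S /= big_ord0.
case=> [n|[|n]].
- by rewrite /S (_ : n%:Z + 1 = n.+1%:Z) /= ?big_ord_recr //; lia.
- rewrite (_ : Negz 0 + 1 = 0) /S; last by lia.
  by rewrite /= big_ord_recr !big_ord0 /= addbb.
- rewrite (_ : Negz n.+1 + 1 = Negz n) /S; last by lia.
  by rewrite /= [in RHS]big_ord_recr /= addbK.
Qed.

(* The first cohomology mod 2 of the square grid vanishes. *)
Lemma cochain_exact (f1 f2 : int -> int -> bool) :
  (forall x y, f1 x y (+) f2 (x + 1) y = f2 x y (+) f1 x (y + 1)) ->
  exists g : int -> int -> bool,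
    (forall x y, g (x + 1) y = g x y (+) f1 x y) /\
    (forall x y, g x (y + 1) = g x y (+) f2 x y).
Proof.
move=> H.
have [S0 [_ S0S]] := bool_primitive (fun x => f1 x 0).
have [S HS] := choice (fun x => bool_primitive (f2 x)).
(* Integration runs along the horizontal axis, then vertically. The horizontal increments at height
   y follow by induction on y, with closedness on a unit square as the inductive step. *)
exists (fun x y => S0 x (+) S x y); split=> x y; last by rewrite (HS x).2 addbA.
rewrite S0S; suff -> : S (x + 1) y = S x y (+) f1 x 0 (+) f1 x y.
  by case: (S0 x) (f1 x 0) (S x y) (f1 x y) => [] [] [] [].
move: y; apply: int_ind_both => [|y].
  by rewrite (HS x).1 (HS (x + 1)).1; case: (f1 x 0).
rewrite (HS x).2 (HS (x + 1)).2; have := H x y.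
move: (f1 x y) (f1 x (y + 1)) (f2 x y) (f2 (x + 1) y) (f1 x 0).
by move: (S (x + 1) y) (S x y) => [] [] [] [] [] [] [].
Qed.

(** The truth table behind the closedness of the cochain in [grid_connected_remove]. At the corners
    p00, p10, p01, p11 of a unit square, [qi] stands for membership in [Q] and [ui] for membership
    in [U1]; once a corner is in [Q], adjacent corners outside [Q] agree about [U1]. *)
Lemma square_parity (q0 q1 q2 q3 u0 u1 u2 u3 : bool) :
  let q := [|| q0, q1, q2 | q3] in
  q ==> ~~ q0 ==> ~~ q1 ==> (u0 == u1) -> q ==> ~~ q1 ==> ~~ q3 ==> (u1 == u3) ->
  q ==> ~~ q0 ==> ~~ q2 ==> (u0 == u2) -> q ==> ~~ q2 ==> ~~ q3 ==> (u2 == u3) ->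
  ~~ (q0 && u0) -> ~~ (q1 && u1) -> ~~ (q2 && u2) -> ~~ (q3 && u3) ->
  ((q0 && u1) (+) (q1 && u0)) (+) ((q1 && u3) (+) (q3 && u1)) =
  ((q0 && u2) (+) (q2 && u0)) (+) ((q2 && u3) (+) (q3 && u2)).
Proof. by move: q0 q1 q2 q3 u0 u1 u2 u3; do 8!case. Qed.

(* Join u in U1 := (component of a in U \ Q) to Q by a mod 2 cochain: it is
   closed, and its primitive is constant on Q and on the complement of Q, so
   either every neighbour of Q or none of them lies in U1. *)
Lemma grid_connected_remove (U Q : Z2 -> Prop) :
  grid_connected U -> grid_connected Q -> grid_connected (fun z => ~ Q z) ->
  (forall z z', Q z -> nearby 1 z z' -> U z') ->
  grid_connected (fun z => U z /\ ~ Q z).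
Proof.
move=> cU cQ cnQ QU a b Ua Ub; apply: contrapT => nab.
pose U1 z := [/\ U z, ~ Q z & grid_conn (fun z => U z /\ ~ Q z) a z].
have U1a : U1 a by case: Ua => ? ?; split=> //; exact: rt_refl.
have nU1b : ~ U1 b by case.
have U1adj z z' : U1 z -> U z' -> ~ Q z' -> adj z z' -> U1 z'.
  move=> [Uz nQz az] Uz' nQz' zz'; split=> //; apply: rt_trans az _.
  exact: rt_step.
pose f u v := `[< Q u >] && `[< U1 v >] (+) `[< Q v >] && `[< U1 u >].
have fC u v : f u v = f v u by rewrite /f addbC.
have fK u v : ~ Q u -> ~ Q v -> f u v = false.
  by rewrite /f => /asboolPn/negbTE -> /asboolPn/negbTE ->.
pose p (x y : int) : Z2 := (x, y).
have [x y|g [g1 g2]] := @cochain_exact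
    (fun x y => f (p x y) (p (x + 1) y)) (fun x y => f (p x y) (p x (y + 1))).
  set p00 := p x y; set p10 := p (x + 1) y; set p01 := p x (y + 1).
  set p11 := p (x + 1) (y + 1).
  have sq z z' : adj z z' -> z \in [:: p00; p10; p01; p11] ->
      z' \in [:: p00; p10; p01; p11] ->
      [|| `[< Q p00 >], `[< Q p10 >], `[< Q p01 >] | `[< Q p11 >]] ==>
      ~~ `[< Q z >] ==> ~~ `[< Q z' >] ==> (`[< U1 z >] == `[< U1 z' >]).
    move=> zz' zi z'i; apply/implyP => hQ; apply/implyP => /asboolPn nQz.
    apply/implyP => /asboolPn nQz'; apply/eqP.
    have [q qi Qq] : exists2 q, q \in [:: p00; p10; p01; p11] & Q q.
      by case/or4P: hQ => /asboolP ?; [exists p00|exists p10|exists p01|exists p11];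
        rewrite // !inE eqxx ?orbT.
    have nq z1 : z1 \in [:: p00; p10; p01; p11] -> U z1.
      move=> z1i; apply: (QU q) => //.
      move: qi z1i; rewrite !inE /nearby /p00 /p10 /p01 /p11 /p.
      by case/or4P=> /eqP ->; case/or4P=> /eqP -> /=; lia.
    apply/asboolP/asboolP => h; first by apply: (U1adj z) => //; exact: nq.
    by apply: (U1adj z') => //; [exact: nq|rewrite adjC].
  have QnU1 z : ~~ (`[< Q z >] && `[< U1 z >]).
    by apply/negP => /andP[/asboolP Qz /asboolP[_]].
  have [a1 a2 a3 a4] : [/\ adj p00 p10, adj p10 p11, adj p00 p01 & adj p01 p11].
    by rewrite /adj /=; split; lia.
  by apply: square_parity (sq p00 p10 _ _ _) (sq p10 p11 _ _ _)
    (sq p00 p01 _ _ _) (sq p01 p11 _ _ _) _ _ _ _; rewrite // !inE eqxx ?orbT.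
have gadj u v : adj u v -> g v.1 v.2 = g u.1 u.2 (+) f u v.
  case: u v => [a1 a2] [b1 b2]; rewrite /adj /= => ab.
  have [E|[E|[E|E]]] : (b1 = a1 + 1 /\ b2 = a2) \/ (a1 = b1 + 1 /\ b2 = a2) \/
      (b2 = a2 + 1 /\ b1 = a1) \/ (a2 = b2 + 1 /\ b1 = a1) by lia.
  - by case: E => -> ->; exact: g1.
  - by case: E => -> ->; rewrite g1 fC addbK.
  - by case: E => -> ->; exact: g2.
  - by case: E => -> ->; rewrite g2 fC addbK.
have gcst (A : Z2 -> Prop) u v : grid_conn A u v ->
    (forall u v, A u -> A v -> f u v = false) -> g u.1 u.2 = g v.1 v.2.
  move=> uv fA; apply: (crt_inv (P := fun w => g u.1 u.2 = g w.1 w.2) _ uv) => //.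
  by move=> x y [Ax Ay xy] ->; rewrite (gadj x y) // fA ?addbF.
have gQ u v : Q u -> Q v -> g u.1 u.2 = g v.1 v.2.
  move=> Qu Qv; apply: (gcst Q); first exact: cQ.
  move=> x y Qx Qy.
  have nU1 z : Q z -> ~ U1 z by move=> Qz [_ nQz _]; exact: nQz.
  by rewrite /f !(asboolF (nU1 _ _)) ?andbF.
have gnQ u v : ~ Q u -> ~ Q v -> g u.1 u.2 = g v.1 v.2.
  by move=> ? ?; apply: (gcst (fun z => ~ Q z)); [exact: cnQ|exact: fK].
have fE q v : Q q -> ~ Q v -> f q v = `[< U1 v >].
  by move=> Qq nQv; rewrite /f (asboolT Qq) (asboolF nQv) addbF.
have fcst q v q' v' : adj q v -> adj q' v' -> Q q -> ~ Q v -> Q q' -> ~ Q v' ->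
    U1 v -> U1 v'.
  move=> qv qv' Qq nQv Qq' nQv' U1v; apply/asboolP; rewrite -(fE q') //.
  have := gadj _ _ qv; have := gadj _ _ qv'.
  rewrite (gQ q' q) // (gnQ v' v) // => ->; rewrite (fE q v) // asboolT //.
  by case: (g _ _) (f q' v') => [] [].
(* If some neighbour of [Q] lies in [U1], then all neighbours outside [Q] do, and [U1] together with
   [Q] is closed under steps in [U]; otherwise [U1] alone is. Either way [b] would lie in the closed
   set. *)
have [[q [v [qv Qq U1v]]]|none] := pselect (exists q v, [/\ adj q v, Q q & U1 v]).
  apply: nU1b; have [//|Qb] : U1 b \/ Q b; last by case: Ub.
  apply: (crt_inv (P := fun z => U1 z \/ Q z) _ (cU a b Ua.1 Ub.1)); last by left.
  move=> x y [Ux Uy xy] xU; have [Qy|nQy] := pselect (Q y); first by right.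
  left; case: xU => [U1x|Qx]; first exact: (U1adj x).
  apply: (fcst q v x y) => //; by case: U1v.
apply: nU1b; apply: (crt_inv (P := U1) _ (cU a b Ua.1 Ub.1)) => //.
move=> x y [Ux Uy xy] U1x; apply: (U1adj x) => // Qy; apply: none.
by exists y, x; rewrite adjC.
Qed.

(** The sets are removed one by one. The neighbourhood of each avoids the others, so it still lies
    in what is left of [U] and [grid_connected_remove] applies again. *)
Lemma grid_connected_removes (T : eqType) (ts : seq T) (U : Z2 -> Prop)
    (Q : T -> Z2 -> Prop) :
  uniq ts -> grid_connected U ->
  (forall t, t \in ts -> grid_connected (Q t)) ->
  (forall t, t \in ts -> grid_connected (fun z => ~ Q t z)) ->
  (forall t z z', t \in ts -> Q t z -> nearby 1 z z' -> U z') ->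
  (forall t t' z z', t \in ts -> t' \in ts -> t != t' -> Q t z -> nearby 1 z z' ->
    ~ Q t' z') ->
  grid_connected (fun z => U z /\ forall t, t \in ts -> ~ Q t z).
Proof.
elim: ts => [_ cU _ _ _ _|t ts IH /= /andP[tts uts] cU cQ cnQ QU QQ].
  by apply: grid_connected_ext cU => z; split=> [|[]].
have := @grid_connected_remove (fun z => U z /\ forall t, t \in ts -> ~ Q t z) (Q t).
have tI : t \in t :: ts by rewrite mem_head.
have tsI t' : t' \in ts -> t' \in t :: ts by rewrite inE orbC => ->.
move=> H; apply: grid_connected_ext (H _ _ _ _) => [z||||z z' Qz zz'].
- split=> [[[Uz tz] tz']|[Uz tz]]; split=> //.
  + by move=> t' /predU1P[->|/tz].
  + by split=> // t' /tsI/tz.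
  + exact: tz.
- apply: IH => //.
  + by move=> t' /tsI/cQ.
  + by move=> t' /tsI/cnQ.
  + by move=> t' z z' /tsI/QU; apply.
  + by move=> t1 t2 z z' /tsI t1I /tsI t2I; exact: QQ.
- exact: cQ.
- exact: cnQ.
- split; first exact: (QU t z).
  move=> t' t'ts; apply: (QQ t t' z) => //; first exact: tsI.
  by apply: contraNneq tts => ->.
Qed.

Lemma grid_conn_box (A : Z2 -> Prop) (a b c d : int) (u v : Z2) :
  (forall z : Z2, a <= z.1 <= b -> c <= z.2 <= d -> A z) ->
  a <= u.1 <= b -> c <= u.2 <= d -> a <= v.1 <= b -> c <= v.2 <= d ->
  grid_conn A u v.
Proof.
case: u v => [u1 u2] [v1 v2] H /= ? ? ? ?; apply: (@rt_trans _ _ _ (v1, u2)).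
  by apply: grid_conn_hseg => x ?; apply: H => /=; lia.
by apply: grid_conn_vseg => y ?; apply: H => /=; lia.
Qed.

(** * Unions of 16 x 16 blocks and their enlargements *)

Definition blk (z : Z2) : Z2 := ((z.1 %/ 16)%Z, (z.2 %/ 16)%Z).

(* The union of the 16 x 16 blocks with index in A, enlarged by w horizontally
   and h vertically; since 2 w and 2 h are less than 16, a point belongs to it
   as soon as one of the corners of the surrounding box lies in such a block. *)
Definition blow (A : Z2 -> Prop) (w h : int) (z : Z2) : Prop :=
  A (blk (z.1 - w, z.2 - h)) \/ A (blk (z.1 + w, z.2 - h)) \/
  A (blk (z.1 - w, z.2 + h)) \/ A (blk (z.1 + w, z.2 + h)).

(** A cell of the block with index [b] that stays in this block when moved by at most 7 in each
    coordinate. *)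
Definition ctr (b : Z2) : Z2 := (16 * b.1 + 8, 16 * b.2 + 8).

Lemma blow_rect (A : Z2 -> Prop) (w h : int) (b z : Z2) : 0 <= w <= 7 -> 0 <= h <= 7 ->
  A b -> 16 * b.1 - w <= z.1 <= 16 * b.1 + 15 + w ->
  16 * b.2 - h <= z.2 <= 16 * b.2 + 15 + h -> blow A w h z.
Proof.
case: b z => [b1 b2] [x y] /= w7 h7 Ab xb yb; rewrite /blow /blk /=.
have [Ex|Ex] : ((x - w) %/ 16)%Z = b1 \/ ((x + w) %/ 16)%Z = b1 by lia.
all: have [Ey|Ey] : ((y - h) %/ 16)%Z = b2 \/ ((y + h) %/ 16)%Z = b2 by lia.
all: rewrite Ex Ey; tauto.
Qed.

Lemma blowP (A : Z2 -> Prop) (w h : int) (z : Z2) : 0 <= w <= 7 -> 0 <= h <= 7 ->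
  blow A w h z ->
  exists b, [/\ A b, 16 * b.1 - w <= z.1 <= 16 * b.1 + 15 + w &
    16 * b.2 - h <= z.2 <= 16 * b.2 + 15 + h].
Proof.
case: z => [x y] w7 h7; rewrite /blow /blk /=.
by case=> [|[|[|]]] Ab; eexists; split; [exact: Ab|rewrite /=; lia|rewrite /=; lia
  |exact: Ab|rewrite /=; lia|rewrite /=; lia|exact: Ab|rewrite /=; lia|rewrite /=; lia
  |exact: Ab|rewrite /=; lia|rewrite /=; lia].
Qed.

(** Every cell reaches the centre of a block of [A] inside the enlarged block, and centres of
    adjacent blocks are joined by a segment. *)
Lemma blow_connected (A : Z2 -> Prop) (w h : int) : 0 <= w <= 7 -> 0 <= h <= 7 ->
  grid_connected A -> grid_connected (blow A w h).
Proof.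
move=> w7 h7 cA u v Zu Zv.
have [b [Ab xb yb]] := blowP w7 h7 Zu; have [c [Ac xc yc]] := blowP w7 h7 Zv.
have toc a z : A a -> 16 * a.1 - w <= z.1 <= 16 * a.1 + 15 + w ->
    16 * a.2 - h <= z.2 <= 16 * a.2 + 15 + h -> grid_conn (blow A w h) z (ctr a).
  move=> Ab' xb' yb'; apply: (@grid_conn_box _ _ _ _ _ z (ctr a) _ xb' yb').
  - by move=> z' ? ?; exact: (blow_rect w7 h7 Ab').
  - by rewrite /ctr /=; lia.
  - by rewrite /ctr /=; lia.
apply: rt_trans (toc _ _ Ab xb yb) (rt_trans _ _ _ _ _ _ (grid_conn_sym (toc _ _ Ac xc yc))).
apply: (crt_map (f := ctr)) (cA b c Ab Ac) => x y [Ax Ay xy].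
have /orP[E|E] : (x.2 == y.2) || (x.1 == y.1) by move: xy; rewrite /adj; lia.
  rewrite /ctr -(eqP E); apply: grid_conn_hseg => z zxy.
  have [?|?] : (16 * x.1 <= z <= 16 * x.1 + 15) \/ (16 * y.1 <= z <= 16 * y.1 + 15).
  - by move: xy; rewrite /adj; lia.
  - by apply: (blow_rect w7 h7 Ax) => /=; lia.
  - by apply: (blow_rect w7 h7 Ay) => /=; lia.
rewrite /ctr -(eqP E); apply: grid_conn_vseg => z zxy.
have [?|?] : (16 * x.2 <= z <= 16 * x.2 + 15) \/ (16 * y.2 <= z <= 16 * y.2 + 15).
- by move: xy; rewrite /adj; lia.
- by apply: (blow_rect w7 h7 Ax) => /=; lia.
- by apply: (blow_rect w7 h7 Ay) => /=; lia.
Qed.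

Lemma nblowP (A : Z2 -> Prop) (w h : int) (z : Z2) :
  ~ blow A w h z <-> forall x y, (x == z.1 - w) || (x == z.1 + w) ->
    (y == z.2 - h) || (y == z.2 + h) -> ~ A (blk (x, y)).
Proof.
split=> [nb x y xE yE Ab|H].
  by apply: nb; case/orP: xE Ab => /eqP ->; case/orP: yE => /eqP ->; rewrite /blow; tauto.
by case=> [|[|[|]]]; apply: H; rewrite eqxx ?orbT.
Qed.

(** As a cell moves to the centre of its block, first horizontally and then vertically, the corners
    of the box around it only visit blocks that contained a corner at the start, so the cell never
    enters the enlargement. *)
Lemma blow_coconnected (A : Z2 -> Prop) (w h : int) : 0 <= w <= 7 -> 0 <= h <= 7 ->
  grid_connected (fun b => ~ A b) -> grid_connected (fun z => ~ blow A w h z).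
Proof.
move=> w7 h7 cA.
have ctrP b x y : ~ A b -> 16 * b.1 + 8 - w <= x <= 16 * b.1 + 8 + w ->
    16 * b.2 + 8 - h <= y <= 16 * b.2 + 8 + h -> ~ A (blk (x, y)).
  move=> nAb ? ?; suff -> : blk (x, y) = b by [].
  by rewrite [b]surjective_pairing /blk /=; congr pair; lia.
have toc z : ~ blow A w h z -> grid_conn (fun z => ~ blow A w h z) z (ctr (blk z)).
  case: z => x y /nblowP nz; rewrite /ctr /=.
  apply: (@rt_trans _ _ _ ((16 * (x %/ 16)%Z + 8, y) : Z2)).
    apply: grid_conn_hseg => x' x'x; apply/nblowP => /= a b aE bE Ab.
    have Ea : (a %/ 16)%Z = ((x - w) %/ 16)%Z \/ (a %/ 16)%Z = ((x + w) %/ 16)%Z by lia.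
    case: Ea => Ea; move: Ab; rewrite /blk /= Ea.
      by apply: (nz (x - w) b) => //=; rewrite eqxx.
    by apply: (nz (x + w) b) => //=; rewrite eqxx orbT.
  apply: grid_conn_vseg => y' y'y; apply/nblowP => /= a b aE bE Ab.
  have Eb : (b %/ 16)%Z = ((y - h) %/ 16)%Z \/ (b %/ 16)%Z = ((y + h) %/ 16)%Z by lia.
  have Ea : (a %/ 16)%Z = ((x - w) %/ 16)%Z \/ (a %/ 16)%Z = ((x + w) %/ 16)%Z by lia.
  move: Ab; rewrite /blk /=.
  by case: Ea => ->; case: Eb => -> /=;
    [apply: (nz (x - w) (y - h))|apply: (nz (x - w) (y + h))
    |apply: (nz (x + w) (y - h))|apply: (nz (x + w) (y + h))];
    rewrite /= eqxx ?orbT.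
have nA z : ~ blow A w h z -> ~ A (blk z).
  move=> nz Ab; apply: nz; apply: (blow_rect w7 h7 Ab); rewrite /blk /=; lia.
move=> u v nu nv; apply: rt_trans (toc _ nu) (rt_trans _ _ _ _ _ _ (grid_conn_sym (toc _ nv))).
apply: (crt_map (f := ctr)) (cA _ _ (nA _ nu) (nA _ nv)) => x y [nAx nAy xy].
have /orP[E|E] : (x.2 == y.2) || (x.1 == y.1) by move: xy; rewrite /adj; lia.
  rewrite /ctr -(eqP E); apply: grid_conn_hseg => z zxy; apply/nblowP => /= a b aE bE.
  have [?|?] : (16 * x.1 <= a <= 16 * x.1 + 15) \/ (16 * y.1 <= a <= 16 * y.1 + 15).
  - by move: xy; rewrite /adj; lia.
  - suff -> : blk (a, b) = x by [].
    by rewrite [x in RHS]surjective_pairing /blk /=; congr pair; lia.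
  - suff -> : blk (a, b) = y by [].
    by rewrite [y in RHS]surjective_pairing /blk /=; congr pair; lia.
rewrite /ctr -(eqP E); apply: grid_conn_vseg => z zxy; apply/nblowP => /= a b aE bE.
have [?|?] : (16 * x.2 <= b <= 16 * x.2 + 15) \/ (16 * y.2 <= b <= 16 * y.2 + 15).
- by move: xy; rewrite /adj; lia.
- suff -> : blk (a, b) = x by [].
  by rewrite [x in RHS]surjective_pairing /blk /=; congr pair; lia.
- suff -> : blk (a, b) = y by [].
  by rewrite [y in RHS]surjective_pairing /blk /=; congr pair; lia.
Qed.

(* F is the complement of the component of the complement of A that contains
   the far corner (L + 1, L + 1). *)
Lemma grid_fill (A : Z2 -> Prop) (L : int) : grid_connected A -> 0 <= L ->
  (forall b, A b -> nearby L b 0) ->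
  exists F : Z2 -> Prop, [/\ forall b, A b -> F b, forall b, F b -> nearby L b 0,
    grid_connected F, grid_connected (fun b => ~ F b) &
    forall b c, ~ A b -> ~ A c -> adj b c -> F b -> F c].
Proof.
move=> cA L0 AL; pose z0 : Z2 := (L + 1, L + 1).
pose O b := grid_conn (fun b => ~ A b) z0 b /\ ~ A b.
have far b : ~~ nearby L b 0 -> ~ A b by move=> nb /AL; exact/negP.
have Oz0 : O z0.
  by split; [exact: rt_refl|apply: far; rewrite /nearby /=; lia].
have Oadj b c : O b -> ~ A c -> adj b c -> O c.
  move=> [z0b nb] nc bc; split=> //; apply: rt_trans z0b _.
  exact: rt_step.
have Oconn b c : O b -> ~ A c -> grid_conn (fun b => ~ A b) b c -> O c.
  by move=> [z0b nb] nc bc; split=> //; apply: rt_trans z0b bc.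
have farO b : ~~ nearby L b 0 -> O b.
  move=> nb; apply: Oconn Oz0 (far _ nb) _; apply: grid_conn_sym.
  case: b nb => x y nb; rewrite /z0.
  have corner (u : int) : (u == L + 1) -> forall v v' : int,
      grid_conn (fun b => ~ A b) (v, u) (v', u).
    by move=> uL v v'; apply: grid_conn_hseg => t _; apply: far; rewrite /nearby /=; lia.
  have [xL|xL] := boolP (`|x| <= L); last first.
    apply: (@rt_trans _ _ _ ((x, L + 1) : Z2)); last exact: corner.
    by apply: grid_conn_vseg => t _; apply: far; rewrite /nearby /=; lia.
  apply: (@rt_trans _ _ _ ((L + 1, y) : Z2)).
    by apply: grid_conn_hseg => t _; apply: far; move: nb; rewrite /nearby /=; lia.
  by apply: grid_conn_vseg => t _; apply: far; rewrite /nearby /=; lia.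
exists (fun b => ~ O b); split.
- by move=> b Ab [_].
- by move=> b nO; apply: contrapT => /negP/farO.
(* Walking to the right from a cell of the filled set stays in it until [A] is met, which must
   happen because far cells belong to [O]. *)
- have toA b : ~ O b -> exists2 a, A a & grid_conn (fun b => ~ O b) b a.
    case: b => x y; have [n] := ubnP (absz (L + 1 - x)%R).
    elim: n x => [|n IH] x E nO; first by [].
    have [xL|xL] := leP x L; last first.
      by case: nO; apply: farO; rewrite /nearby /=; lia.
    have [Ab|nAb] := pselect (A (x, y)); first by exists (x, y) => //; exact: rt_refl.
    have nO' : ~ O (x + 1, y).
      by move=> O'; apply: nO; apply: Oadj O' nAb _; rewrite /adj /=; lia.
    have [|a Aa xa] := IH (x + 1) _ nO'; first by lia.
    exists a => //; apply: rt_trans xa; apply: rt_step; split=> //.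
    by rewrite /adj /=; lia.
  move=> b c /toA[a Aa ba] /toA[a' Aa' ca'].
  apply: rt_trans ba (rt_trans _ _ _ _ _ _ (grid_conn_sym ca')).
  by apply: grid_conn_sub (cA _ _ Aa Aa') => z Az [].
- apply: (@grid_connected_ext O) => [b|]; first by split=> [? //|/contrapT].
  have z0O b : O b -> grid_conn O z0 b.
    case=> z0b nb; apply: (crt_inv (P := fun b => O b /\ grid_conn O z0 b) _ z0b _).2;
      last by split=> //; exact: rt_refl.
    move=> x y [nx ny xy] [Ox z0x]; split; first exact: (Oadj x).
    by apply: rt_trans z0x (rt_step _ _ _ _ _); split=> //; exact: (Oadj x).
  by move=> b c /z0O ? /z0O ?; apply: rt_trans (grid_conn_sym _) _; eassumption.
- by move=> b c nb nc bc nO Oc; apply: nO; apply: Oadj Oc nb _; rewrite adjC.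
Qed.

(** * Weaving tiles and pieces into a path *)

Definition steps (T : Type) (s : seq T) := zip s (behead s).

Definition link (T : eqType) (s : seq T) (u v : T) : bool :=
  ((u, v) \in steps s) || ((v, u) \in steps s).

Definition walk (s : seq Z2) : bool := all (fun p => adj p.1 p.2) (steps s).

Section Steps.
Variable T : eqType.
Implicit Types (s t : seq T) (u v x : T).

Lemma steps_cat s1 x s2 :
  steps (s1 ++ x :: s2) = steps (rcons s1 x) ++ steps (x :: s2).
Proof.
elim: s1 => [|y s1 IH] //; rewrite rcons_cons cat_cons /steps /=.
case: s1 IH => [|z s1] IH //=; congr cons.
by move: IH; rewrite /steps /=.
Qed.

Lemma stepsP s u v :
  reflect (exists s1 s2, s = s1 ++ u :: v :: s2) ((u, v) \in steps s).
Proof.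
apply: (iffP idP) => [|[s1 [s2 ->]]]; last first.
  by rewrite steps_cat mem_cat [steps (u :: _)]/= inE eqxx orbT.
elim: s => [|x [|y s] IH] //; rewrite /steps /= inE => /orP[/eqP[-> ->]|uv].
  by exists [::], s.
by have [s1 [s2 ->]] := IH uv; exists (x :: s1), s2.
Qed.

Lemma linkC s u v : link s u v = link s v u.
Proof. by rewrite /link orbC. Qed.

Lemma steps_rev s u v : ((u, v) \in steps (rev s)) = ((v, u) \in steps s).
Proof.
wlog suff H : s u v / (v, u) \in steps s -> (u, v) \in steps (rev s).
  by apply/idP/idP => [/H|/H]; rewrite ?revK.
move=> /stepsP[s1 [s2 ->]]; apply/stepsP; exists (rev s2), (rev s1).
by rewrite rev_cat !rev_cons -!cats1 -!catA.
Qed.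

Lemma link_rev s u v : link (rev s) u v = link s u v.
Proof. by rewrite /link !steps_rev orbC. Qed.

Lemma steps_mem s u v : (u, v) \in steps s -> (u \in s) && (v \in s).
Proof. by case/stepsP=> s1 [s2 ->]; rewrite !mem_cat !inE !eqxx !orbT. Qed.

Lemma link_mem s u v : link s u v -> (u \in s) && (v \in s).
Proof. by case/orP => /steps_mem // /andP[-> ->]. Qed.

End Steps.

Lemma head_rev (T : Type) (x : T) s : head x (rev s) = last x s.
Proof. by elim/last_ind: s => // s y _; rewrite rev_rcons last_rcons. Qed.

Lemma last_rev (T : Type) (x : T) s : last x (rev s) = head x s.
Proof. by rewrite -head_rev revK. Qed.

Lemma walk_rev s : walk (rev s) = walk s.
Proof.
by apply/allP/allP => H [u v] uv; rewrite adjC /=; apply: (H (v, u)) => /=;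
  rewrite ?steps_rev // -steps_rev ?revK.
Qed.

(** [t] takes the place of the edge between [u] and [v], the only link of [s] that is lost; if [s]
    runs through this edge from [v] to [u], then [t] is inserted in reverse. *)
Lemma splice (s t : seq Z2) u v :
  uniq s -> uniq t -> ~~ has (mem s) t -> walk s -> walk t -> link s u v ->
  t != [::] -> adj u (head 0 t) -> adj (last 0 t) v ->
  exists s', [/\ [/\ uniq s', walk s' & s' =i s ++ t],
    head 0 s' = head 0 s, last 0 s' = last 0 s,
    forall x y, link s x y -> (x, y) != (u, v) -> (x, y) != (v, u) -> link s' x y &
    forall x y, link t x y -> link s' x y].
Proof.
wlog : t u v / (u, v) \in steps s => [H us ut st ws wt /orP[uv|vu]|].
- by apply: H => //; rewrite /link uv.
- move=> t0 ut' tv; have [] := H (rev t) v u vu; rewrite ?rev_uniq //.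
  + by apply: contraNN st => /hasP[x]; rewrite mem_rev => xt xs; apply/hasP; exists x.
  + by rewrite walk_rev.
  + by rewrite /link vu.
  + by rewrite -size_eq0 size_rev size_eq0.
  + by rewrite head_rev adjC.
  + by rewrite last_rev adjC.
  move=> s' [[us' ws' s's] hs ls Hs Ht]; exists s'; split=> //.
  + by split=> // x; rewrite s's !mem_cat mem_rev.
  + by move=> x y xy xyu xyv; apply: Hs.
  + by move=> x y xy; apply: Ht; rewrite link_rev.
move=> /stepsP[s1 [s2 sE]] us ut st ws wt _ t0 ut' tv.
exists (s1 ++ u :: t ++ v :: s2).
have E : perm_eq (s1 ++ u :: t ++ v :: s2) (s ++ t).
  by rewrite sE -catA perm_cat2l /= perm_cons perm_catC.
have S0 : steps s = steps (rcons s1 u) ++ (u, v) :: steps (v :: s2).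
  by rewrite sE steps_cat.
have S1 : steps (s1 ++ u :: t ++ v :: s2) = steps (rcons s1 u) ++
    (u, head 0 t) :: steps t ++ (last 0 t, v) :: steps (v :: s2).
  rewrite steps_cat; congr cat.
  have -> : steps (u :: t ++ v :: s2) = (u, head 0 t) :: steps (t ++ v :: s2).
    by case: t t0 {ut st wt ut' tv E} => [|x t].
  congr cons; case/lastP: t t0 {ut st wt ut' tv E} => [//|t x] _.
  by rewrite cat_rcons steps_cat last_rcons.
split.
- split; last exact: perm_mem.
  + by rewrite (perm_uniq E) cat_uniq us ut st.
  + move: ws wt; rewrite /walk S0 S1 !all_cat /= all_cat /= => /and3P[-> _ ->] ->.
    by rewrite ut' tv.
- by rewrite sE; case: s1 {sE E S0 S1}.
- by rewrite sE !last_cat /= last_cat.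
- move=> x y; rewrite /link S0 S1 !mem_cat !inE !mem_cat !inE => xy n1 n2.
  by move: xy n1 n2; rewrite !xpair_eqE; do !case: (_ == _) => //=;
   do !case: (_ \in _) => //=.
- by move=> x y; rewrite /link S1 !mem_cat !inE !mem_cat => /orP[] ->; rewrite !orbT.
Qed.

Definition shift (c : Z2) (s : seq Z2) : seq Z2 := [seq c + z | z <- s].

Lemma steps_shift c s :
  steps (shift c s) = [seq (c + p.1, c + p.2) | p <- steps s].
Proof.
case: s => [|x s] //=; rewrite /steps /=.
by elim: s x => //= y s IH x; rewrite IH.
Qed.

Lemma adj_shift c u v : adj (c + u) (c + v) = adj u v.
Proof. by case: c u v => ? ? [? ?] [? ?]; rewrite /adj /=; lia. Qed.

Lemma near_shift k c u v : nearby k (c + u) (c + v) = nearby k u v.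
Proof. by case: c u v => ? ? [? ?] [? ?]; rewrite /nearby /=; lia. Qed.

Lemma walk_shift c s : walk (shift c s) = walk s.
Proof. by rewrite /walk steps_shift all_map; apply: eq_all => p /=; exact: adj_shift. Qed.

Lemma link_shift c s u v : link (shift c s) (c + u) (c + v) = link s u v.
Proof.
have inj : injective (fun p : Z2 * Z2 => (c + p.1, c + p.2)).
  by move=> [a b] [a' b'] /= /pair_equal_spec[/addrI -> /addrI ->].
rewrite /link steps_shift; congr (_ || _).
  exact: (mem_map inj (steps s) (u, v)).
exact: (mem_map inj (steps s) (v, u)).
Qed.

Lemma mem_shift c s z : (c + z \in shift c s) = (z \in s).
Proof. by rewrite mem_map //; exact: addrI. Qed.

Lemma mem_shiftE c s z : (z \in shift c s) = (z - c \in s).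
Proof. by rewrite -(mem_shift c) addrC subrK. Qed.

(* A tile is a rectangle, given by its lower left corner and its dimensions. *)
Definition in_tile (t : Z2 * Z2) (z : Z2) : bool :=
  (t.1.1 <= z.1 < t.1.1 + t.2.1) && (t.1.2 <= z.2 < t.1.2 + t.2.2).

Definition units : seq Z2 := [:: (1, 0); (-1, 0); (0, 1); (0, -1)].

Definition tile_dims : seq Z2 := [:: (2, 2); (2, 3); (3, 2)].

(* d is the outward normal of the side of t that contains the edge uv. *)
Definition tile_side (t : Z2 * Z2) (u v d : Z2) : bool :=
  [&& in_tile t u, in_tile t v, adj u v, d \in units,
    ~~ in_tile t (u + d) & ~~ in_tile t (v + d)].

Definition tile_cycle (d : Z2) : seq Z2 :=
  if d == (2, 2) then [:: (0, 0); (1, 0); (1, 1); (0, 1)]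
  else if d == (2, 3) then [:: (0, 0); (1, 0); (1, 1); (1, 2); (0, 2); (0, 1)]
  else [:: (0, 0); (1, 0); (2, 0); (2, 1); (1, 1); (0, 1)].

(* Nested conditionals rather than && keep call-by-value evaluation cheap. *)
Definition tile_path_ok (t : Z2 * Z2) (u v : Z2) (p : seq Z2) : bool :=
  if (head 0 p == u) && (last 0 p == v) then
    [&& uniq p, walk p, size p != 0%N &
    all (fun x => all (fun y => all (fun d => if tile_side t x y d then
      [|| link p x y, (x, y) == (u, v) | (x, y) == (v, u)] else true) units)
      (tile_cycle t.2)) (tile_cycle t.2)]
  else false.

(** Cutting the cycle open at the side edge [uv] gives a path from [u] to [v] that keeps all other
    side edges. The cycles have length 4 or 6, so six rotations and their reversals include every
    way to cut. *)
Lemma tile_path_check : all (fun dim => let c := tile_cycle dim in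
  all (fun u => all (fun v => all (fun d => if tile_side (0, dim) u v d then
   has (fun k => tile_path_ok (0, dim) u v (rot k c)
              || tile_path_ok (0, dim) u v (rev (rot k c))) (iota 0 6) else true)
    units) c) c) tile_dims.
Proof. by vm_compute. Qed.

Lemma tile_cycleE dim z : dim \in tile_dims ->
  (z \in tile_cycle dim) = in_tile (0, dim) z.
Proof.
case: z => x y; rewrite !inE => /or3P[] /eqP ->;
  rewrite /tile_cycle /in_tile /= !inE !xpair_eqE; lia.
Qed.

Lemma in_tile_shift c (dim z : Z2) : in_tile (c, dim) (c + z) = in_tile (0, dim) z.
Proof. by case: c dim z => ? ? [? ?] [? ?]; rewrite /in_tile /=; lia. Qed.

Lemma tile_side_shift c (dim u v d : Z2) :
  tile_side (c, dim) (c + u) (c + v) d = tile_side (0, dim) u v d.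
Proof. by rewrite /tile_side -!addrA !in_tile_shift adj_shift. Qed.

Lemma tile_path t u v d : t.2 \in tile_dims -> tile_side t u v d ->
  exists p : seq Z2, [/\ [/\ uniq p, walk p & p != [::]],
    forall z, (z \in p) = in_tile t z, head 0 p = u, last 0 p = v &
    forall x y d', tile_side t x y d' ->
      [\/ link p x y, (x, y) = (u, v) | (x, y) = (v, u)]].
Proof.
case: t => c dim /= dimT.
have -> : u = c + (u - c) by rewrite addrC subrK.
have -> : v = c + (v - c) by rewrite addrC subrK.
move: (u - c) (v - c) => {}u {}v; rewrite tile_side_shift => uvd.
have [du dv dd] : [/\ u \in tile_cycle dim, v \in tile_cycle dim & d \in units].
  by rewrite !tile_cycleE //; case/and5P: uvd => -> -> _ -> _.
have /allP/(_ _ dimT)/allP/(_ _ du)/allP/(_ _ dv)/allP/(_ _ dd) := tile_path_check.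
rewrite uvd => /hasP[k _ ok].
have [p pE] : exists2 p, p =i tile_cycle dim & tile_path_ok (0, dim) u v p.
  case/orP: ok => ok; eexists; try exact: ok; move=> z; rewrite ?mem_rev mem_rot //.
rewrite /tile_path_ok; case: ifP => // /andP[/eqP hp /eqP lp].
move=> /and4P[up wp sp /allP sides].
exists (shift c p); split.
- split; first by rewrite map_inj_uniq //; exact: addrI.
  + by rewrite walk_shift.
  + by move: sp; case: (p).
- by move=> z; rewrite mem_shiftE pE tile_cycleE // -(in_tile_shift c) addrC subrK.
- by move: sp hp; case: (p) => //= a l _ ->.
- by move: sp lp; case: (p) => //= a l _ <-; rewrite (last_map (+%R c)).
move=> x y d'; have -> : x = c + (x - c) by rewrite addrC subrK.
have -> : y = c + (y - c) by rewrite addrC subrK.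
move: (x - c) (y - c) => {}x {}y; rewrite tile_side_shift link_shift => xyd.
have [xI yI dI] : [/\ x \in tile_cycle dim, y \in tile_cycle dim & d' \in units].
  by rewrite !tile_cycleE //; case/and5P: xyd => -> -> _ -> _.
move: (sides x xI) => /allP/(_ _ yI)/allP/(_ _ dI); rewrite xyd.
by case/or3P => [->|/eqP[-> ->]|/eqP[-> ->]]; [constructor 1|constructor 2|constructor 3].
Qed.

(** Both dimensions of a tile are at least 2, so no edge runs along two of its sides. *)
Lemma tile_side_uniq t u v d d' : t.2 \in tile_dims ->
  tile_side t u v d -> tile_side t u v d' -> d = d'.
Proof.
case: t u v => [[t1 t2] [w h]] [u1 u2] [v1 v2].
rewrite !inE /tile_side => wh /and5P[tu tv uv dU /andP[nu nv]].
move=> /and5P[_ _ _ dU' /andP[nu' nv']].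
move: wh dU dU' nu nv nu' nv' tu tv uv; rewrite !inE /in_tile /adj !xpair_eqE /=.
by move=> wh /or4P[] /eqP -> /or4P[] /eqP -> //=; lia.
Qed.

Lemma tile_sideC t u v d : tile_side t u v d = tile_side t v u d.
Proof.
rewrite /tile_side adjC.
by case: (in_tile t u) (in_tile t v) (in_tile t (u + d)) (in_tile t (v + d)) =>
  [] [] [] [].
Qed.

Lemma units_opp d : d \in units -> - d \in units.
Proof. by rewrite !inE => /or4P[] /eqP ->. Qed.

Lemma adj_units u d : d \in units -> adj u (u + d).
Proof.
by case: u => ? ?; rewrite !inE /adj => /or4P[] /eqP -> /=; lia.
Qed.

(** * Joining the tiles of a region into one path *)

Section WeaveTiles.
Variables (R T : Z2 -> Prop) (tau : Z2 -> Z2 * Z2) (L : seq Z2).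
Hypothesis TR : forall z, T z -> R z.
Hypothesis TL : forall z, T z -> z \in L.
Hypothesis tau_dims : forall z, T z -> (tau z).2 \in tile_dims.
Hypothesis tau_in : forall z, T z -> in_tile (tau z) z.
Hypothesis tau_eq : forall z z', T z -> in_tile (tau z) z' -> T z' /\ tau z' = tau z.

Definition tile_link (z z' : Z2) : Prop :=
  [/\ T z, T z' & tau z = tau z' \/ exists u v d, [/\ tile_side (tau z) u v d,
    in_tile (tau z') (u + d) & in_tile (tau z') (v + d)]].

Variables (z0 a b d0 : Z2).
Hypothesis Tz0 : T z0.
Hypothesis T_conn : forall z, T z -> clos_refl_trans Z2 tile_link z0 z.
Hypothesis root_side : tile_side (tau z0) a b d0.
Hypothesis na : ~ R (a + d0).
Hypothesis nb : ~ R (b + d0).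

(** The invariant that keeps the weaving going: an edge on a tile side is still a link as long as
    the cells across it are in [R] and not in [s]. At the end it provides the links at which the
    earlier pieces, lying in [R] but outside [T], can be inserted. *)
Let sides (s : seq Z2) := forall z u v d, z \in s -> tile_side (tau z) u v d ->
  R (u + d) -> R (v + d) -> u + d \notin s -> v + d \notin s -> link s u v.

Let woven (s : seq Z2) := [/\ [/\ uniq s, walk s & forall z, z \in s -> T z],
  forall z z', z \in s -> in_tile (tau z) z' -> z' \in s,
  head 0 s = a /\ last 0 s = b, z0 \in s & sides s].

(** The root tile is cut open at the edge from [a] to [b]; this edge faces cells outside [R], so the
    invariant does not ask for it. *)
Let woven_root : exists s, woven s.
Proof.
have [p [[up wp p0] pE hp lp plink]] := tile_path (tau_dims Tz0) root_side.
exists p; split=> //.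
- by split=> // z; rewrite pE => /(tau_eq Tz0)[].
- by move=> z z'; rewrite !pE => /(tau_eq Tz0)[_ ->].
- by rewrite pE tau_in.
- move=> z u v d; rewrite pE => /(tau_eq Tz0)[_ ->] uvd Ru Rv _ _.
  have [//|[E1 E2]|[E1 E2]] := plink _ _ _ uvd.
    by case: na; rewrite -E1 (tile_side_uniq _ root_side (d' := d)) ?tau_dims // -?E1 -?E2.
  case: nb; rewrite -E1 (tile_side_uniq _ root_side (d' := d)) ?tau_dims //.
  by rewrite -E1 -E2 tile_sideC.
Qed.

Let woven_step s z : woven s -> T z -> z \notin s ->
  exists s', woven s' /\ (size s < size s')%N.
Proof.
move=> [[us ws sT] scl [hs ls] z0s ss] Tz zs.
have [x [y [[Tx Ty xy] xs ys]]] := crt_exit (P := fun z => z \in s) (T_conn Tz) z0s (negP zs).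
have {}ys : y \notin s by apply/negP.
case: xy => [E|[u [v [d [uvd u'y v'y]]]]].
  by case/negP: ys; apply: (scl x) => //; rewrite E tau_in.
have ynots c : in_tile (tau y) c -> c \notin s.
  move=> cy; apply: contraNN ys => cs; have [_ E] := tau_eq Ty cy.
  by apply: (scl c) => //; rewrite E tau_in.
have [xu xv uv dU] : [/\ in_tile (tau x) u, in_tile (tau x) v, adj u v &
    d \in units] by case/and5P: uvd.
have [us' vs'] : u \in s /\ v \in s by split; apply: (scl x).
have uvd' : tile_side (tau y) (u + d) (v + d) (- d).
  rewrite /tile_side u'y v'y ![_ + d]addrC adj_shift uv units_opp //=.
  by rewrite ![d + _]addrC !addrK; apply/andP; split; apply/negP => /ynots;
    rewrite ?us' ?vs'.
have [p [[up wp p0] pE hp lp plink]] := tile_path (tau_dims Ty) uvd'.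
have ps : ~~ has (mem s) p by apply/hasPn => c; rewrite pE; exact: ynots.
have luv : link s u v.
  by apply: (ss x _ _ d) => //; try exact: ynots;
    apply: TR; [have [] := tau_eq Ty u'y|have [] := tau_eq Ty v'y].
have [||s' [[us'' ws' s'E] hs' ls' lss' lps']] := splice us up ps ws wp luv p0.
- by rewrite hp adj_units.
- by rewrite lp adjC adj_units.
have s's c : c \notin s' -> c \notin s.
  by apply: contraNN; rewrite s'E mem_cat => ->.
exists s'; split; last first.
  have /perm_size -> : perm_eq s' (s ++ p).
    by apply: uniq_perm => //; rewrite cat_uniq us ps.
  by rewrite size_cat; case: (p) p0 => //= ? ? _; rewrite addnS ltnS leq_addr.
split.
- split=> // c; rewrite s'E mem_cat pE => /orP[/sT //|/(tau_eq Ty)[]//].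
- move=> c c'; rewrite !s'E !mem_cat !pE => /orP[cs|cy] cc'.
    by rewrite (scl c).
  by rewrite -(tau_eq Ty cy).2 cc' orbT.
- by rewrite hs' ls'.
- by rewrite s'E mem_cat z0s.
(* The lost link [uv] now faces the new tile, and the open edge of the new tile faces [u] and [v].
   By [tile_side_uniq] these edges lie on no other side of their tiles, so the invariant asks for
   neither. *)
move=> c u2 v2 d2; rewrite s'E mem_cat pE => /orP[cs|cy] uvd2 Ru Rv nu nv.
  have tcx : in_tile (tau c) u -> tau c = tau x.
    by move=> cu; rewrite -(tau_eq (sT _ cs) cu).2 (tau_eq Tx xu).2.
  have u's' : u + d \in s' by rewrite s'E mem_cat pE u'y orbT.
  have v's' : v + d \in s' by rewrite s'E mem_cat pE v'y orbT.
  apply: lss'; first by apply: (ss c _ _ d2) => //; exact: s's.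
    apply/negP => /eqP[E1 E2]; move: uvd2; rewrite E1 E2 => uvd2.
    have E : tau c = tau x by apply: tcx; case/and3P: uvd2.
    rewrite E in uvd2; case/negP: nu.
    by rewrite E1 -(tile_side_uniq (tau_dims Tx) uvd uvd2).
  apply/negP => /eqP[E1 E2]; move: uvd2; rewrite E1 E2 tile_sideC => uvd2.
  have E : tau c = tau x by apply: tcx; case/and3P: uvd2.
  rewrite E in uvd2; case/negP: nu.
  by rewrite E1 -(tile_side_uniq (tau_dims Tx) uvd uvd2).
move: uvd2; rewrite (tau_eq Ty cy).2 => uvd2.
have ns' : ~~ ((u \notin s') || (v \notin s')).
  by rewrite !s'E !mem_cat us' vs'.
have [/lps' //|[E1 E2]|[E1 E2]] := plink _ _ _ uvd2; case/negP: ns'.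
  move: uvd2 nu; rewrite E1 E2 => /(tile_side_uniq (tau_dims Ty) uvd') <-.
  by rewrite addrK => ->.
move: uvd2 nu; rewrite E1 E2 tile_sideC => /(tile_side_uniq (tau_dims Ty) uvd') <-.
by rewrite addrK => ->; rewrite orbT.
Qed.

Lemma weave_tiles : exists s : seq Z2, [/\ [/\ uniq s, walk s & forall z, z \in s <-> T z],
  head 0 s = a, last 0 s = b &
  forall z u v d, T z -> tile_side (tau z) u v d -> R (u + d) -> R (v + d) ->
    ~ T (u + d) -> ~ T (v + d) -> link s u v].
Proof.
(* Weaving terminates because a woven path has distinct cells, all in the finite list [L]. *)
have fin n s : woven s -> (size L < size s + n)%N ->
    exists s', woven s' /\ forall z, T z -> z \in s'.
  elim: n s => [|n IH] s ws Ln.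
    case: ws => [[us _ sT] _ _ _ _].
    have /(uniq_leq_size us) : {subset s <= L} by move=> z /sT/TL.
    by rewrite leqNgt -[size s]addn0 Ln.
  have [|/existsNP[z /not_implyP[Tz /negP zs]]] := pselect (forall z, T z -> z \in s).
    by exists s.
  have [s' [ws' ss']] := woven_step ws Tz zs.
  by apply: (IH s') => //; lia.
have [s0 ws0] := woven_root.
have [|s [[[us ws sT] _ [hs ls] _ ss] Ts]] := fin (size L).+1 s0 ws0.
  by rewrite addnS ltnS leq_addl.
exists s; split=> //; first by split=> // z; split=> [/sT|/Ts].
move=> z u v d Tz uvd Ru Rv nu nv; apply: (ss z _ _ d) => //; first exact: Ts.
  by apply/negP => /sT.
by apply/negP => /sT.
Qed.

End WeaveTiles.

(** The insertion edges are distinct links of [s], so inserting one piece leaves those of the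
    others. The last clause carries the links of a piece already inserted through the remaining
    insertions. *)
Lemma weave_pieces (s : seq Z2) (ts : seq (seq Z2)) (ex : seq Z2 -> Z2 * Z2) :
  uniq s -> walk s -> uniq ts ->
  (forall t, t \in ts -> [/\ uniq t, walk t & t != [::]]) ->
  (forall t, t \in ts -> ~~ has (mem s) t) ->
  (forall t t', t \in ts -> t' \in ts -> t != t' -> ~~ has (mem t') t) ->
  (forall t, t \in ts -> [/\ link s (ex t).1 (ex t).2, adj (ex t).1 (head 0 t) &
    adj (last 0 t) (ex t).2]) ->
  (forall t t', t \in ts -> t' \in ts -> t != t' ->
    (ex t != ex t') && (ex t != ((ex t').2, (ex t').1))) ->
  exists s' : seq Z2, [/\ [/\ uniq s', walk s' &
      forall z, z \in s' <-> z \in s \/ exists2 t, t \in ts & z \in t],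
    head 0 s' = head 0 s, last 0 s' = last 0 s,
    forall t, t \in ts -> forall x y, link t x y -> link s' x y &
    forall x y, link s x y -> (forall t, t \in ts -> ((x, y) != ex t) &&
      ((x, y) != ((ex t).2, (ex t).1))) -> link s' x y].
Proof.
 elim: ts s => [s us ws _ _ _ _ _ _|t ts IH s us ws].
  exists s; split=> //; split=> // z; split=> [zs|[//|[? //]]]; by left.
move=> /= /andP[tts uts] Hp Hs Hd He Hne.
have tI : t \in t :: ts by rewrite mem_head.
have tsI t' : t' \in ts -> t' \in t :: ts by rewrite inE orbC => ->.
have [ut wt t0] := Hp t tI; have [lt adjh adjl] := He t tI.
have [s1 [[us1 ws1 s1E] hs1 ls1 Hl1 Ht1]] :=
  splice us ut (Hs t tI) ws wt lt t0 adjh adjl.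
have neq t' : t' \in ts -> t' != t by apply: contraTneq => ->.
have exE t' : t' \in ts -> ((ex t').1, (ex t').2) = ex t' by case: (ex t').
have [t' t'I|t' t'I|t1 t2 t1I t2I|t' t'I|t1 t2 t1I t2I|] := IH s1 us1 ws1 uts.
- exact/Hp/tsI.
- apply/hasPn => x xt'; rewrite /= s1E mem_cat negb_or.
  by rewrite (hasPn (Hs _ (tsI _ t'I)) _ xt') (hasPn (Hd _ _ (tsI _ t'I) tI (neq _ t'I)) _ xt').
- exact: Hd (tsI _ t1I) (tsI _ t2I).
- have [lt' ? ?] := He _ (tsI _ t'I); split=> //.
  have /andP[n1 n2] := Hne _ _ (tsI _ t'I) tI (neq _ t'I).
  by apply: Hl1; rewrite // exE.
- exact: Hne (tsI _ t1I) (tsI _ t2I).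
move=> s' [[us' ws' s'E] hs' ls' Hl' Hk']; exists s'; split.
- split=> // z; rewrite s'E s1E mem_cat; split.
    case=> [/orP[zs|zt]|[t' t'I zt']]; [by left|by right; exists t|].
    by right; exists t' => //; exact: tsI.
  case=> [->|[t' /predU1P[->|t'I] zt']]; [by left|by left; rewrite zt' orbT|].
  by right; exists t'.
- by rewrite hs'.
- by rewrite ls'.
- move=> t' /predU1P[->|t'I] x y xy; last exact: Hl' xy.
  apply: Hk' (Ht1 _ _ xy) _ => t2 t2I.
  have [/link_mem /andP[x1 x2] _ _] := He _ (tsI _ t2I).
  have /andP[xt _] := link_mem xy.
  have xs : x \notin s by apply: (hasPn (Hs t tI)).
  by apply/andP; split; apply: contraNneq xs => E;
    have /= -> := congr1 fst E.
move=> x y xy xyn; apply: Hk'; last by move=> t' t'I; apply/xyn/tsI.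
by have /andP[n1 n2] := xyn t tI; apply: Hl1; rewrite -?surjective_pairing.
Qed.

(** * Collars around misaligned pieces *)

Definition side_link (t t' : Z2 * Z2) : Prop :=
  exists u v d, [/\ tile_side t u v d, in_tile t' (u + d) & in_tile t' (v + d)].

Section Zone.
Variables (a : Z2 -> bool) (w h : int).
Hypothesis w23 : (w == 2) || (w == 3).
Hypothesis h23 : (h == 2) || (h == 3).

(* Hypotheses about a only slow lia down. *)
Local Ltac la := repeat match goal with H : context [a] |- _ => clear H end; lia.

Definition zone (z : Z2) : bool :=
  [|| a (blk (z.1 - w, z.2 - h)), a (blk (z.1 + w, z.2 - h)),
      a (blk (z.1 - w, z.2 + h)) | a (blk (z.1 + w, z.2 + h))].

Definition collar (z : Z2) : bool := zone z && ~~ a (blk z).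

(** The grid of 2 x 2 squares whose lines have the parity of [w] and [h]: the sides of the zone, at
    16 i - w and 16 i + 16 + w and likewise vertically, lie on its lines. *)
Definition outer_tile (z : Z2) : Z2 * Z2 :=
  ((z.1 - ((z.1 - w) %% 2)%Z, z.2 - ((z.2 - h) %% 2)%Z), (2, 2)).

(* The widths w and h are 2 or 3, whichever makes the sides of the zone even in
   the coordinates of the surrounding region. The four cases are the tiles to
   the right and to the left of the blow-up P of a, then those above and below
   the horizontal enlargement of P. *)
Definition collar_tile (z : Z2) : Z2 * Z2 :=
  let: (x, y) := z in
  if a (blk (x - w, y)) then ((16 * (x %/ 16)%Z, 2 * (y %/ 2)%Z), (w, 2))
  else if a (blk (x + w, y)) then
    ((16 * (x %/ 16)%Z + 16 - w, 2 * (y %/ 2)%Z), (w, 2))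
  else if a (blk (x - w, y - h)) || a (blk (x + w, y - h)) then
    ((x - ((x - w) %% 2)%Z, 16 * (y %/ 16)%Z), (2, h))
  else ((x - ((x - w) %% 2)%Z, 16 * (y %/ 16)%Z + 16 - h), (2, h)).

Lemma blk_eq (x y x' y' : int) : (x %/ 16)%Z = (x' %/ 16)%Z -> (y %/ 16)%Z = (y' %/ 16)%Z ->
  blk (x, y) = blk (x', y').
Proof. by rewrite /blk /= => -> ->. Qed.

Lemma collar_tile_dims z : (collar_tile z).2 \in tile_dims.
Proof.
case: z => x y; rewrite /collar_tile !inE.
by case/orP: w23 => /eqP ->; case/orP: h23 => /eqP ->; do !case: ifP => _.
Qed.

Lemma collar_tile_in z : collar z -> in_tile (collar_tile z) z.
Proof.
case: z => x y; rewrite /collar /zone /collar_tile /in_tile /= => /andP[Zz nP].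
case: ifP => [a1|a1] /=.
  have : (x %/ 16)%Z != ((x - w) %/ 16)%Z by apply: contraNneq nP => E; rewrite (blk_eq E (erefl (y %/ 16)%Z)).
  by la.
case: ifP => [a2|a2] /=.
  have : (x %/ 16)%Z != ((x + w) %/ 16)%Z by apply: contraNneq nP => E; rewrite (blk_eq E (erefl (y %/ 16)%Z)).
  by la.
case: ifP => [a3|a3] /=.
  have : (y %/ 16)%Z != ((y - h) %/ 16)%Z.
    apply/eqP => E; move: a3 a1 a2.
    by rewrite -(blk_eq (erefl ((x - w) %/ 16)%Z) E) -(blk_eq (erefl ((x + w) %/ 16)%Z) E) => /orP[] ->.
  by la.
have : (y %/ 16)%Z != ((y + h) %/ 16)%Z.
  apply/eqP => E; move: Zz a3 a1 a2.
  by rewrite -(blk_eq (erefl ((x - w) %/ 16)%Z) E) -(blk_eq (erefl ((x + w) %/ 16)%Z) E) => /or4P[] ->;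
    rewrite ?orbT.
by la.
Qed.

Lemma zone_rect (b z : Z2) : a b -> 16 * b.1 - w <= z.1 <= 16 * b.1 + 15 + w ->
  16 * b.2 - h <= z.2 <= 16 * b.2 + 15 + h -> zone z.
Proof.
move=> ab xb yb; have := @blow_rect a w h b z.
have w7 : 0 <= w <= 7 by la.
have h7 : 0 <= h <= 7 by la.
by move=> /(_ w7 h7 ab xb yb); rewrite /blow /zone => -[|[|[|]]] ->; rewrite ?orbT.
Qed.

(** All cells of a tile give the same answers to the tests in [collar_tile], so the tiles partition
    the collar. *)
Lemma collar_tile_eq z z' : collar z -> in_tile (collar_tile z) z' ->
  collar z' /\ collar_tile z' = collar_tile z.
Proof.
move=> cz; have := collar_tile_in cz.
case: z z' cz => x y [x' y']; rewrite {1}/collar {1}/zone /collar_tile /in_tile /= => /andP[Zz nP].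
case: ifP => [a1|a1] /=.
  move=> zin z'in.
  have Ey : (y' %/ 16)%Z = (y %/ 16)%Z by la.
  have Ex : ((x' - w) %/ 16)%Z = ((x - w) %/ 16)%Z by la.
  have Ex0 : (x' %/ 16)%Z = (x %/ 16)%Z by la.
  rewrite (blk_eq Ex Ey) a1 /collar (blk_eq Ex0 Ey) nP andbT; split.
    by apply: (zone_rect a1); rewrite /blk /=; la.
  by congr (_, _, _); la.
case: ifP => [a2|a2] /=.
  move=> zin z'in.
  have Ey : (y' %/ 16)%Z = (y %/ 16)%Z by la.
  have Ex : ((x' - w) %/ 16)%Z = (x %/ 16)%Z by la.
  have Ex1 : ((x' + w) %/ 16)%Z = ((x + w) %/ 16)%Z by la.
  have Ex0 : (x' %/ 16)%Z = (x %/ 16)%Z by la.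
  rewrite (blk_eq Ex Ey) (negbTE nP) (blk_eq Ex1 Ey) a2 /collar (blk_eq Ex0 Ey) nP andbT; split.
    by apply: (zone_rect a2); rewrite /blk /=; la.
  by congr (_, _, _); la.
have nP' x1 y1 : (x1 %/ 16)%Z = ((x - w) %/ 16)%Z \/ (x1 %/ 16)%Z = ((x + w) %/ 16)%Z ->
    (y1 %/ 16)%Z = (y %/ 16)%Z -> a (blk (x1, y1)) = false.
  by case=> E E'; rewrite (blk_eq E E').
case: ifP => [a3|a3] /=.
  move=> zin z'in.
  have Ey : (y' %/ 16)%Z = (y %/ 16)%Z by la.
  have Eyh : ((y' - h) %/ 16)%Z = ((y - h) %/ 16)%Z by la.
  have Ex : ((x' - w) %/ 16)%Z = ((x - w) %/ 16)%Z by la.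
  have Ex1 : ((x' + w) %/ 16)%Z = ((x + w) %/ 16)%Z by la.
  have b1 : a (blk (x' - w, y')) = false by apply: nP' => //; left.
  have b2 : a (blk (x' + w, y')) = false by apply: nP' => //; right.
  rewrite b1 b2 (blk_eq Ex Eyh) (blk_eq Ex1 Eyh) a3 /collar nP' //; last by la.
  rewrite andbT; split; last by congr (_, _, _); la.
  by rewrite /zone /= (blk_eq Ex Eyh) (blk_eq Ex1 Eyh); case/orP: a3 => ->; rewrite ?orbT.
move=> zin z'in.
have Ey : (y' %/ 16)%Z = (y %/ 16)%Z by la.
have Eyh : ((y' + h) %/ 16)%Z = ((y + h) %/ 16)%Z by la.
have Ex : ((x' - w) %/ 16)%Z = ((x - w) %/ 16)%Z by la.
have Ex1 : ((x' + w) %/ 16)%Z = ((x + w) %/ 16)%Z by la.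
have Eyh' : ((y' - h) %/ 16)%Z = (y %/ 16)%Z by la.
have b1 : a (blk (x' - w, y')) = false by apply: nP' => //; left.
have b2 : a (blk (x' + w, y')) = false by apply: nP' => //; right.
have b3 : a (blk (x' - w, y' - h)) = false by apply: nP' => //; left.
have b4 : a (blk (x' + w, y' - h)) = false by apply: nP' => //; right.
rewrite b1 b2 b3 b4 /=.
rewrite /collar nP' //; last by la.
rewrite andbT; split; last by congr (_, _, _); la.
rewrite /zone /= (blk_eq Ex Eyh) (blk_eq Ex1 Eyh).
by move: Zz a3; case/or4P=> ->; rewrite ?orbT.
Qed.

Lemma outer_tile_zone z z' : in_tile (outer_tile z) z' -> zone z' = zone z.
Proof.
case: z z' => x y [x' y']; rewrite /in_tile /outer_tile /zone /= => zz'.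
by congr [|| _, _, _ | _]; congr (a _); apply: blk_eq; la.
Qed.

Definition collar_link (z z' : Z2) : Prop :=
  [/\ collar z, collar z' & side_link (collar_tile z) (collar_tile z')].

(** Just beyond a tile above or below the piece lies a square outside the zone: the corners tested
    there are in the block row of [y] and in the block columns of [x - w] and [x + w], where no
    block belongs to [a]. *)
Lemma horizontal_collar_link x y : collar (x, y) -> ~~ a (blk (x - w, y)) ->
  ~~ a (blk (x + w, y)) ->
  exists o, [/\ ~~ zone o, side_link (collar_tile (x, y)) (outer_tile o) &
    nearby 4 (x, y) o].
Proof.
move=> cz; have := collar_tile_in cz; move: cz; rewrite /collar /collar_tile.
move=> /andP[Zz nP] zin /negbTE a1 /negbTE a2; move: zin; rewrite a1 a2.
have nP' x1 y1 : (x1 %/ 16)%Z = ((x - w) %/ 16)%Z \/ (x1 %/ 16)%Z = ((x + w) %/ 16)%Z ->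
    (y1 %/ 16)%Z = (y %/ 16)%Z -> a (blk (x1, y1)) = false.
  by case=> E E'; rewrite (blk_eq E E').
set c := x - ((x - w) %% 2)%Z.
have Ex : ((c - w) %/ 16)%Z = ((x - w) %/ 16)%Z by la.
have Ex1 : ((c + w) %/ 16)%Z = ((x + w) %/ 16)%Z by la.
case: ifP => a3; rewrite /in_tile /= => zin.
  exists (c, 16 * (y %/ 16)%Z + h); split.
  - by rewrite /zone /= !nP' //; la.
  - exists (c, 16 * (y %/ 16)%Z + h - 1), (c + 1, 16 * (y %/ 16)%Z + h - 1), (0, 1).
    by rewrite /tile_side /in_tile /outer_tile /adj !inE /=; split; la.
  - by rewrite /nearby /=; la.
exists (c, 16 * (y %/ 16)%Z + 15 - h); split.
- by rewrite /zone /= !nP' //; la.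
- exists (c, 16 * (y %/ 16)%Z + 16 - h), (c + 1, 16 * (y %/ 16)%Z + 16 - h), (0, -1).
  by rewrite /tile_side /in_tile /outer_tile /adj !inE /=; split; la.
- by rewrite /nearby /=; la.
Qed.

Definition upright (z : Z2) : bool := a (blk (z.1 - w, z.2)) || a (blk (z.1 + w, z.2)).

Lemma collar_tile_right x y : a (blk (x - w, y)) ->
  collar_tile (x, y) = ((16 * (x %/ 16)%Z, 2 * (y %/ 2)%Z), (w, 2)).
Proof. by rewrite /collar_tile => ->. Qed.

Lemma collar_tile_left x y : ~~ a (blk (x - w, y)) -> a (blk (x + w, y)) ->
  collar_tile (x, y) = ((16 * (x %/ 16)%Z + 16 - w, 2 * (y %/ 2)%Z), (w, 2)).
Proof. by rewrite /collar_tile => /negbTE -> ->. Qed.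

Lemma collar_tile_above x y : ~~ upright (x, y) ->
  a (blk (x - w, y - h)) || a (blk (x + w, y - h)) ->
  collar_tile (x, y) = ((x - ((x - w) %% 2)%Z, 16 * (y %/ 16)%Z), (2, h)).
Proof. by rewrite /collar_tile negb_or => /andP[/negbTE -> /negbTE ->] ->. Qed.

Lemma collar_tile_below x y : ~~ upright (x, y) ->
  ~~ a (blk (x - w, y - h)) -> ~~ a (blk (x + w, y - h)) ->
  collar_tile (x, y) = ((x - ((x - w) %% 2)%Z, 16 * (y %/ 16)%Z + 16 - h), (2, h)).
Proof.
by rewrite /collar_tile negb_or => /andP[/negbTE -> /negbTE ->] /negbTE -> /negbTE ->.
Qed.

Lemma blkE (x y i j : int) : 16 * i <= x <= 16 * i + 15 -> 16 * j <= y <= 16 * j + 15 ->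
  blk (x, y) = (i, j).
Proof. by move=> ? ?; rewrite /blk /=; congr pair; la. Qed.

(** Along the right side of the piece one climbs tile by tile; at the top of a block row the blocks
    (X, Y + 1) and (X - 1, Y + 1) decide how to go on. *)
Lemma right_collar_step x y : collar (x, y) -> a (blk (x - w, y)) ->
  exists2 z', collar_link (x, y) z' & ~~ upright z' \/ y < z'.2.
Proof.
move=> cz a1; have zin := collar_tile_in cz.
have tE := collar_tile_right a1; rewrite tE /in_tile /= in zin.
set X := (x %/ 16)%Z in tE zin; set Y := (y %/ 16)%Z.
have nXY : ~~ a (X, Y) by case/andP: cz.
have aXY : a (X - 1, Y) by rewrite -(_ : blk (x - w, y) = (X - 1, Y)) //; apply: blkE; la.
have [yY|yY] := boolP ((2 * (y %/ 2)%Z + 2) %/ 16 == Y)%Z.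
  have c' : collar (x, 2 * (y %/ 2)%Z + 2).
    rewrite /collar (zone_rect aXY) /= ?(@blkE _ _ X Y) //; la.
  have a1' : a (blk (x - w, 2 * (y %/ 2)%Z + 2)) by rewrite (@blkE _ _ (X - 1) Y) //; la.
  exists (x, 2 * (y %/ 2)%Z + 2); last by right => /=; la.
  split=> //; rewrite tE collar_tile_right // -/X.
  exists (16 * X, 2 * (y %/ 2)%Z + 1), (16 * X + 1, 2 * (y %/ 2)%Z + 1), (0, 1).
  by rewrite /tile_side /in_tile /adj !inE /=; split; la.
have {}yY : 2 * (y %/ 2)%Z = 16 * Y + 14 by la.
(* Under a block of the piece, a tile hanging below that block is reached sideways. *)
have [aT|naT] := boolP (a (X, Y + 1)).
  have u' : ~~ upright (16 * X + w, 16 * Y + 15).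
    by rewrite /upright /= !(@blkE _ _ X Y) ?negb_or ?nXY //; la.
  have c' : collar (16 * X + w, 16 * Y + 15).
    by rewrite /collar (zone_rect aT) /= ?(@blkE _ _ X Y) //; la.
  exists (16 * X + w, 16 * Y + 15); last by left.
  split=> //; rewrite tE collar_tile_below // ?(@blkE _ _ X Y) //; try la.
  exists (16 * X + w - 1, 16 * Y + 14), (16 * X + w - 1, 16 * Y + 15), (1, 0).
  by rewrite /tile_side /in_tile /adj !inE /=; split; la.
(* Where the side of the piece continues upwards, so do the tiles to its right. *)
have [aL|naL] := boolP (a (X - 1, Y + 1)).
  have c' : collar (x, 16 * Y + 16).
    by rewrite /collar (zone_rect aL) /= ?(@blkE _ _ X (Y + 1)) //; la.
  exists (x, 16 * Y + 16); last by right => /=; la.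
  have a1' : a (blk (x - w, 16 * Y + 16)) by rewrite (@blkE _ _ (X - 1) (Y + 1)) //; la.
  split=> //; rewrite tE collar_tile_right // -/X.
  exists (16 * X, 16 * Y + 15), (16 * X + 1, 16 * Y + 15), (0, 1).
  by rewrite /tile_side /in_tile /adj !inE /=; split; la.
(* At a convex corner the next tile up lies above the horizontally enlarged piece. *)
have u' : ~~ upright (16 * X + w - 2, 16 * Y + 16).
  rewrite /upright /= (@blkE _ _ (X - 1) (Y + 1)); [|la|la].
  by rewrite (@blkE _ _ X (Y + 1)) ?negb_or ?naL ?naT //; la.
have c' : collar (16 * X + w - 2, 16 * Y + 16).
  by rewrite /collar (zone_rect aXY) /= ?(@blkE _ _ X (Y + 1)) //; la.
exists (16 * X + w - 2, 16 * Y + 16); last by left.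
split=> //; rewrite tE collar_tile_above //.
  exists (16 * X + w - 2, 16 * Y + 15), (16 * X + w - 1, 16 * Y + 15), (0, 1).
  by rewrite /tile_side /in_tile /adj !inE /=; split; la.
by rewrite (@blkE _ _ (X - 1) Y) ?aXY //; la.
Qed.

(** The mirror image of [right_collar_step]. *)
Lemma left_collar_step x y : collar (x, y) -> ~~ a (blk (x - w, y)) ->
  a (blk (x + w, y)) ->
  exists2 z', collar_link (x, y) z' & ~~ upright z' \/ y < z'.2.
Proof.
move=> cz a1 a2; have zin := collar_tile_in cz.
have tE := collar_tile_left a1 a2; rewrite tE /in_tile /= in zin.
set X := (x %/ 16)%Z in tE zin; set Y := (y %/ 16)%Z.
have nXY : ~~ a (X, Y) by case/andP: cz.
have aXY : a (X + 1, Y) by rewrite -(_ : blk (x + w, y) = (X + 1, Y)) //; apply: blkE; la.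
have [yY|yY] := boolP ((2 * (y %/ 2)%Z + 2) %/ 16 == Y)%Z.
  have c' : collar (x, 2 * (y %/ 2)%Z + 2).
    rewrite /collar (zone_rect aXY) /= ?(@blkE _ _ X Y) //; la.
  have a1' : ~~ a (blk (x - w, 2 * (y %/ 2)%Z + 2)) by rewrite (@blkE _ _ X Y) //; la.
  have a2' : a (blk (x + w, 2 * (y %/ 2)%Z + 2)) by rewrite (@blkE _ _ (X + 1) Y) //; la.
  exists (x, 2 * (y %/ 2)%Z + 2); last by right => /=; la.
  split=> //; rewrite tE collar_tile_left // -/X.
  exists (16 * X + 14, 2 * (y %/ 2)%Z + 1), (16 * X + 15, 2 * (y %/ 2)%Z + 1), (0, 1).
  by rewrite /tile_side /in_tile /adj !inE /=; split; la.
have {}yY : 2 * (y %/ 2)%Z = 16 * Y + 14 by la.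
have [aT|naT] := boolP (a (X, Y + 1)).
  have u' : ~~ upright (16 * X + 15 - w, 16 * Y + 15).
    by rewrite /upright /= !(@blkE _ _ X Y) ?negb_or ?nXY //; la.
  have c' : collar (16 * X + 15 - w, 16 * Y + 15).
    by rewrite /collar (zone_rect aT) /= ?(@blkE _ _ X Y) //; la.
  exists (16 * X + 15 - w, 16 * Y + 15); last by left.
  split=> //; rewrite tE collar_tile_below // ?(@blkE _ _ X Y) //; try la.
  exists (16 * X + 16 - w, 16 * Y + 14), (16 * X + 16 - w, 16 * Y + 15), (-1, 0).
  by rewrite /tile_side /in_tile /adj !inE /=; split; la.
have [aR|naR] := boolP (a (X + 1, Y + 1)).
  have c' : collar (x, 16 * Y + 16).
    by rewrite /collar (zone_rect aR) /= ?(@blkE _ _ X (Y + 1)) //; la.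
  exists (x, 16 * Y + 16); last by right => /=; la.
  have a1' : ~~ a (blk (x - w, 16 * Y + 16)) by rewrite (@blkE _ _ X (Y + 1)) //; la.
  have a2' : a (blk (x + w, 16 * Y + 16)) by rewrite (@blkE _ _ (X + 1) (Y + 1)) //; la.
  split=> //; rewrite tE collar_tile_left // -/X.
  exists (16 * X + 14, 16 * Y + 15), (16 * X + 15, 16 * Y + 15), (0, 1).
  by rewrite /tile_side /in_tile /adj !inE /=; split; la.
have u' : ~~ upright (16 * X + 16 - w, 16 * Y + 16).
  rewrite /upright /= (@blkE _ _ X (Y + 1)); [|la|la].
  by rewrite (@blkE _ _ (X + 1) (Y + 1)) ?negb_or ?naR ?naT //; la.
have c' : collar (16 * X + 16 - w, 16 * Y + 16).
  by rewrite /collar (zone_rect aXY) /= ?(@blkE _ _ X (Y + 1)) //; la.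
exists (16 * X + 16 - w, 16 * Y + 16); last by left.
split=> //; rewrite tE collar_tile_above //.
  exists (16 * X + 16 - w, 16 * Y + 15), (16 * X + 17 - w, 16 * Y + 15), (0, 1).
  by rewrite /tile_side /in_tile /adj !inE /=; split; la.
by rewrite (@blkE (16 * X + 16 - w + w) _ (X + 1) Y) ?aXY ?orbT //; la.
Qed.

(** Provides the side edge at which a piece gets inserted. Evenness of [y] puts the two cells to the
    right of the ends of the piece into one [w] x 2 tile, hence the parity condition in
    [piece_at]. *)
Lemma collar_exit x y : a (blk (x, y)) -> ~~ a (blk (x + 1, y)) -> modz y 2 = 0 ->
  [/\ collar (x + 1, y), collar_tile (x + 1, y) = ((x + 1, y), (w, 2)) &
    tile_side ((x + 1, y), (w, 2)) (x + 1, y) (x + 1, y + 1) (-1, 0)].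
Proof.
move=> a1 a2 y2; have x16 : modz (x + 1) 16 = 0.
  by apply/eqP; apply: contraNT a2 => ne; rewrite (@blk_eq _ _ x y) //; la.
have a3 : a (blk (x + 1 - w, y)) by rewrite (@blk_eq _ _ x y) //; la.
split.
- by rewrite /collar a2 andbT; apply: (zone_rect a1); rewrite /blk /=; la.
- by rewrite collar_tile_right //; congr (_, _, _); la.
- by rewrite /tile_side /in_tile /adj !inE /=; la.
Qed.

(** Climbing along the piece ends at a tile above or below a block, since by the bound on [a] no
    cell higher than 16 B + 15 is upright. *)
Lemma collar_escape (B : int) z : (forall b, a b -> b.2 <= B) -> collar z ->
  exists z' o, [/\ clos_refl_trans Z2 collar_link z z', collar z', ~~ zone o,
    side_link (collar_tile z') (outer_tile o) & nearby 4 z' o].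
Proof.
move=> aB; have [n] := ubnP (absz (16 * B + 16 - z.2)%R).
elim: n z => // n IH [x y] lt_n cz.
have [up|nup] := boolP (upright (x, y)); last first.
  move: (nup); rewrite negb_or => /andP[a1 a2].
  have [o [no so zo]] := horizontal_collar_link cz a1 a2.
  by exists (x, y), o; split=> //; exact: rt_refl.
have yB : y <= 16 * B + 15.
  by case/orP: up => /aB; rewrite /blk /=; la.
have [z' zz' z'P] : exists2 z', collar_link (x, y) z' & ~~ upright z' \/ y < z'.2.
  have [a1|a1] := boolP (a (blk (x - w, y))); first exact: right_collar_step.
  by apply: left_collar_step => //; move: up; rewrite /upright /= (negbTE a1).
have cz' : collar z' by case: zz'.
have [z1 [o [z'z1 cz1 no so zo]]] : exists z1 o, [/\ clos_refl_trans Z2 collar_link z' z1,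
    collar z1, ~~ zone o, side_link (collar_tile z1) (outer_tile o) & nearby 4 z1 o].
  have [nup'|up'] := boolP (~~ upright z').
    case: z' {zz' z'P} cz' nup' => x' y' cz' nup'.
    move: (nup'); rewrite negb_or => /andP[a1 a2].
    have [o [no so zo]] := horizontal_collar_link cz' a1 a2.
    by exists (x', y'), o; split=> //; exact: rt_refl.
  case: z'P => [nup|yz']; first by rewrite nup in up'.
  apply: IH => //; move: lt_n yz' up'; rewrite negbK => /= lt_n yz' up'.
  have : z'.2 <= 16 * B + 15 by case/orP: up' => /aB; rewrite /blk /=; la.
  by la.
exists z1, o; split=> //; apply: rt_trans z'z1; exact: rt_step.
Qed.
End Zone.

(** * Growing pieces *)

(* Both ends of s are on the right side of the set it runs through, so that s
   can be inserted between two cells of a tile of the collar to its right. *)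
Definition piece_at (p : Z2) (a : Z2 -> bool) (s : seq Z2) : Prop :=
  [/\ forall z : Z2, (z \in s) = a (blk (z - p)), grid_connected a,
    grid_connected (fun b => ~ a b) &
    [/\ last 0 s = head 0 s + (0, 1), head 0 s + (1, 0) \notin s &
      modz (head 0 s - p).2 2 = 0]].

Definition good_piece (s : seq Z2) : Prop :=
  [/\ uniq s, walk s, s != [::] & exists p a, piece_at p a s].

Definition touch (k : int) (s t : seq Z2) : Prop :=
  exists x y, [/\ x \in s, y \in t & nearby k x y].

Definition chain (V : seq Z2 -> Prop) : seq Z2 -> seq Z2 -> Prop :=
  clos_refl_trans (seq Z2) (fun s t => [/\ V s, V t & touch 64 s t]).

(* The last clause is what survives the growth of the pieces: at the next stage
   the clusters of pieces, not the single pieces, are swallowed as a whole. *)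
Definition tame (e : int) (V : seq Z2 -> Prop) : Prop :=
  [/\ forall s, V s -> good_piece s,
    forall s t, V s -> V t -> touch 16 s t -> s = t &
    forall s t, V s -> chain V s t ->
      forall x y, x \in s -> y \in t -> nearby e x y].

Lemma touch_sym k s t : touch k s t -> touch k t s.
Proof. by case=> x [y [? ? ?]]; exists y, x; split=> //; rewrite near_sym. Qed.

Lemma head_in (s : seq Z2) : s != [::] -> head 0 s \in s.
Proof. by case: s => // x s _; rewrite mem_head. Qed.

Lemma last_in (s : seq Z2) : s != [::] -> last 0 s \in s.
Proof. by case/lastP: s => // s x _; rewrite last_rcons mem_rcons mem_head. Qed.

Lemma walk_conn (s : seq Z2) : walk s -> grid_connected (fun z => z \in s).
Proof.
move=> ws; suff H x : x \in s -> grid_conn (fun z => z \in s) (head 0 s) x.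
  by move=> u v us vs; apply: rt_trans (grid_conn_sym (H _ us)) (H _ vs).
elim: s ws => // y [_ _|y' s IH ws]; first by rewrite inE => /eqP ->; exact: rt_refl.
rewrite inE => /predU1P[->|]; first exact: rt_refl.
move: ws; rewrite /walk /steps /= => /andP[yy' ws] xs.
apply: rt_trans (rt_step _ _ _ _ _) (grid_conn_sub _ (IH ws xs)).
  by split=> //; rewrite !inE eqxx ?orbT.
by move=> z zs; rewrite inE zs orbT.
Qed.

Lemma near_conn (A : Z2 -> Prop) (k : int) x z : 0 <= k ->
  (forall z', nearby k x z' -> A z') -> nearby k x z -> grid_conn A x z.
Proof.
move=> k0 H xz; apply: (@grid_conn_box _ (x.1 - k) (x.1 + k) (x.2 - k) (x.2 + k)).
- by move=> z' ? ?; apply: H; rewrite /nearby; lia.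
- by lia.
- by lia.
- by move: xz; rewrite /nearby; lia.
- by move: xz; rewrite /nearby; lia.
Qed.

Lemma adj_blk x y : adj x y -> blk x = blk y \/ adj (blk x) (blk y).
Proof.
case: x y => x1 x2 [y1 y2]; rewrite /adj /blk /= => xy.
have [E|E] : ((x1 %/ 16)%Z = (y1 %/ 16)%Z /\ (x2 %/ 16)%Z = (y2 %/ 16)%Z) \/
  `|(x1 %/ 16)%Z - (y1 %/ 16)%Z| + `|(x2 %/ 16)%Z - (y2 %/ 16)%Z| = 1 by lia.
  by left; rewrite E.1 E.2.
by right; rewrite E.
Qed.

(** * The region filled around a marker at the origin *)

Section Region.
Variables (V : seq Z2 -> Prop) (r e : int).
Hypothesis r0 : 0 <= r.
Hypothesis e0 : 0 <= e.
Hypothesis tV : tame e V.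

Let clus t := V t /\ exists t0, [/\ V t0, chain V t0 t &
  exists x y, [/\ x \in t0, nearby (2 * r) y 0 & nearby 64 x y]].

Let S z := nearby (2 * r) z 0 \/ exists2 t, clus t & z \in t.

(** The margin 32 makes the union connected: two points of [S] at distance at most 64 are joined
    through their midpoint. *)
Let S1 z := exists2 s, S s & nearby 32 s z.

Let A0 b := exists2 z, S1 z & blk z = b.

Let S_S1 z : S z -> S1 z.
Proof. by move=> Sz; exists z => //; rewrite /nearby; lia. Qed.

Let S1_link s s' : S s -> S s' -> nearby 64 s s' -> grid_conn S1 s s'.
Proof.
move=> Ss Ss' ss'; pose m : Z2 := (((s.1 + s'.1) %/ 2)%Z, ((s.2 + s'.2) %/ 2)%Z).
have [sm s'm] : nearby 32 s m /\ nearby 32 s' m by move: ss'; rewrite /nearby /=; lia.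
by apply: (@rt_trans _ _ _ m); [|apply: grid_conn_sym];
  apply: (@near_conn _ 32) => // z' ?; [exists s|exists s'].
Qed.

Let S1_center s : S s -> grid_conn S1 s 0.
Proof.
have ctr z : nearby (2 * r) z 0 -> grid_conn S1 z 0.
  move=> z0; apply: grid_conn_sym; apply: (@near_conn _ (2 * r)).
  - by lia.
  - by move=> z' z'0; apply/S_S1; left; rewrite near_sym.
  - by rewrite near_sym.
case=> [/ctr //|[t [Vt [t0 [Vt0 t0t [x [y [xt0 y0 xy]]]]]] st]].
have c0 : clus t0 by split=> //; exists t0; split=> //; [exact: rt_refl|exists x, y].
have inside t' x' y' : clus t' -> x' \in t' -> y' \in t' -> grid_conn S1 x' y'.
  move=> ct' xt' yt'; have [gV _ _] := tV; have [_ wt' _ _] := gV _ ct'.1.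
  apply: (crt_map (f := id)) (walk_conn wt' xt' yt') => z z' [zt z't zz'].
  by apply: S1_link; [right; exists t'|right; exists t'|move: zz'; rewrite /adj /nearby; lia].
suff : clus t /\ forall z, z \in t -> grid_conn S1 z 0 by case=> _; apply.
apply: (crt_inv (P := fun t => clus t /\ forall z, z \in t -> grid_conn S1 z 0) _ t0t).
  move=> t1 t2 [V1 V2 [x1 [x2 [x1t x2t x12]]]] [c1 H1].
  have c2 : clus t2.
    case: c1 => _ [t3 [V3 t31 t3P]]; split=> //; exists t3; split=> //.
    by apply: rt_trans t31 (rt_step _ _ _ _ _); split=> //; exists x1, x2.
  split=> // z zt2; apply: rt_trans (inside _ _ _ c2 zt2 x2t) (rt_trans _ _ _ _ _ _ (H1 _ x1t)).
  by apply: S1_link; [right; exists t2|right; exists t1|rewrite near_sym].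
split=> // z zt0; apply: rt_trans (inside _ _ _ c0 zt0 xt0) (rt_trans _ _ _ _ _ _ (ctr _ y0)).
by apply: S1_link => //; [right; exists t0|left].
Qed.

Let S1_connected : grid_connected S1.
Proof.
suff H z : S1 z -> grid_conn S1 z 0.
  by move=> u v /H u0 /H v0; apply: rt_trans u0 (grid_conn_sym v0).
case=> s Ss sz; apply: rt_trans (S1_center Ss); apply: grid_conn_sym.
by apply: (@near_conn _ 32) => // z' ?; exists s.
Qed.

Let A0_connected : grid_connected A0.
Proof.
move=> b c [z Sz <-] [z' Sz' <-]; apply: (crt_map (f := blk)) (S1_connected Sz Sz').
move=> x y [Sx Sy /adj_blk[->|xy]]; first exact: rt_refl.
by apply: rt_step; split=> //; [exists x|exists y].
Qed.

Let S_bound z : S z -> nearby (2 * r + e + 64) z 0.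
Proof.
case=> [|[t [Vt [t0 [Vt0 t0t [x [y [xt0 y0 xy]]]]]] zt]].
  by rewrite /nearby; lia.
have [_ _ eV] := tV; have := eV _ _ Vt0 t0t _ _ xt0 zt.
by move: y0 xy; rewrite /nearby /=; lia.
Qed.

Let L : int := ((2 * r + e + 96) %/ 16)%Z + 1.

Let A0_bound b : A0 b -> nearby L b 0.
Proof.
by case=> z [s /S_bound sb sz] <-; move: sb sz; rewrite /nearby /blk /L /=; lia.
Qed.

(** The blocks that meet [S1] are filled. A piece of a swallowed cluster has its 16-neighbourhood
    inside by the margin 32. That of any other piece misses the unfilled blocks of [A0] and is
    connected, so it lies entirely in a filled hole or entirely outside. *)
Lemma region : exists F : Z2 -> Prop, [/\ grid_connected F, grid_connected (fun b => ~ F b),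
  forall z, nearby (2 * r) z 0 -> F (blk z),
  forall z, F (blk z) -> nearby (2 * r + e + 200) z 0 &
  forall t, V t -> (forall x z, x \in t -> nearby 16 x z -> F (blk z)) \/
    (forall x z, x \in t -> nearby 16 x z -> ~ F (blk z))].
Proof.
have [|F [A0F FL cF cnF Fadj]] := grid_fill A0_connected _ A0_bound.
  by rewrite /L; lia.
exists F; split=> //.
- by move=> z z0; apply: A0F; exists z => //; apply: S_S1; left.
- by move=> z /FL; rewrite /nearby /blk /L /=; lia.
move=> t Vt; have [ct|nct] := pselect (clus t).
  left=> x z xt xz; apply: A0F; exists z => //; exists x; first by right; exists t.
  by move: xz; rewrite /nearby; lia.
(* Otherwise [t] would be within 16 + 15 + 32 < 64 of [S], the 15 coming from a common block, and
   would belong to a swallowed cluster. *)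
have nA0 x z : x \in t -> nearby 16 x z -> ~ A0 (blk z).
  move=> xt xz [z' [s Ss sz'] bE]; apply: nct.
  have xs : nearby 64 x s.
    by move: bE xz sz'; rewrite /blk /nearby; case=> ? ?; lia.
  case: Ss => [s0|[t' [Vt' [t0 [Vt0 t0t' H]]] st']].
    by split=> //; exists t; split=> //; [exact: rt_refl|exists x, s].
  split=> //; exists t0; split=> //; apply: rt_trans t0t' (rt_step _ _ _ _ _); split=> //.
  by exists s, x; split=> //; rewrite near_sym.
pose N z := exists2 x, x \in t & nearby 16 x z.
have cN : grid_connected N.
  have H z : N z -> exists2 x, x \in t & grid_conn N z x.
    case=> x xt xz; exists x => //; apply: grid_conn_sym.
    by apply: (@near_conn _ 16) => // z' ?; exists x.
  have [gV _ _] := tV; have [_ wt _ _] := gV _ Vt.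
  move=> u v /H[x xt ux] /H[y yt vy]; apply: rt_trans ux (rt_trans _ _ _ _ _ _ (grid_conn_sym vy)).
  apply: grid_conn_sub (walk_conn wt xt yt) => z zt; exists z => //.
  by rewrite /nearby; lia.
have FN u v : N u -> N v -> F (blk u) -> F (blk v).
  move=> Nu Nv; apply: (crt_inv (P := fun u => F (blk u)) _ (cN _ _ Nu Nv)).
  move=> x y [[x' x't x'x] [y' y't y'y] /adj_blk[-> //|xy]].
  by apply: Fadj => //; [exact: (nA0 x')|exact: (nA0 y')].
have [H|H] := pselect (exists2 z, N z & F (blk z)).
  by left=> x z xt xz; case: H => z' Nz'; apply: FN => //; exists x.
by right=> x z xt xz Fz; apply: H; exists z => //; exists x.
Qed.

End Region.

Lemma box_enum (k : int) : exists L : seq Z2, forall z, nearby k z 0 -> z \in L.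
Proof.
pose I := [seq n%:Z - k | n <- iota 0 (absz (2 * k)%R).+1].
have II (x : int) : `|x| <= k -> x \in I.
  by move=> xk; apply/mapP; exists (absz (x + k)%R); rewrite ?mem_iota; lia.
exists [seq (x, y) | x <- I, y <- I] => -[x y] /andP[xk yk]; rewrite /= in xk yk.
by apply/allpairsPdep; exists x, y; split=> //; apply: II; lia.
Qed.

(** Turns the pieces inside a bounded region, given only as a predicate, into a list: a piece is
    determined by its head, which lies in the finite list [K]. *)
Lemma piece_enum (K : seq Z2) (Q : seq Z2 -> Prop) :
  (forall t, Q t -> head 0 t \in K) ->
  (forall t t', Q t -> Q t' -> head 0 t = head 0 t' -> t = t') ->
  exists ts : seq (seq Z2), uniq ts /\ forall t, t \in ts <-> Q t.
Proof.
move=> QK Qinj; suff [ts [uts tsE]] : exists ts : seq (seq Z2), uniq ts /\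
    forall t, t \in ts <-> (Q t /\ head 0 t \in K).
  by exists ts; split=> // t; rewrite tsE; split=> [[]|Qt] //; split=> //; exact: QK.
elim: K {QK} => [|k K [ts [uts tsE]]]; first by exists [::]; split=> // t; split=> // -[].
have [[t0 [Qt0 t0k]]|none] := pselect (exists t0, Q t0 /\ head 0 t0 = k); last first.
  exists ts; split=> // t; rewrite tsE; split=> [[Qt tK]|[Qt]]; first by rewrite inE tK orbT.
  by case/predU1P => [tk|tK]; [case: none; exists t|split].
exists (undup (t0 :: ts)); split; first exact: undup_uniq.
move=> t; rewrite mem_undup inE; split.
  case/predU1P => [->|/tsE[Qt tK]]; first by rewrite t0k mem_head.
  by rewrite inE tK orbT.
case=> Qt; case/predU1P => [tk|tK]; first by rewrite (Qinj t t0) ?eqxx // t0k.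
by rewrite (tsE t).2 ?orbT.
Qed.

Lemma last_true (P : int -> Prop) (L : int) : P 0 -> (forall n, L < n -> ~ P n) ->
  exists n, P n /\ ~ P (n + 1).
Proof.
move=> P0 PL; apply: contrapT => H.
have all (n : nat) : P n%:Z.
  elim: n => [//|n IH]; apply: contrapT => nP; apply: H; exists n%:Z; split=> //.
  by rewrite (_ : n%:Z + 1 = n.+1%:Z) //; lia.
by apply: (PL ((absz L).+1)%:Z) (all _); lia.
Qed.

Definition even_tile (z : Z2) : Z2 * Z2 :=
  ((2 * (z.1 %/ 2)%Z, 2 * (z.2 %/ 2)%Z), (2, 2)).

Definition tile_shift (p : Z2) (t : Z2 * Z2) : Z2 * Z2 := (p + t.1, t.2).

Lemma in_tile_shiftE p t z : in_tile (tile_shift p t) z = in_tile t (z - p).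
Proof.
by case: p t z => ? ? [[? ?] [? ?]] [? ?]; rewrite /in_tile /tile_shift /=; lia.
Qed.

Lemma tile_side_shiftE p t u v d :
  tile_side (tile_shift p t) u v d = tile_side t (u - p) (v - p) d.
Proof.
rewrite /tile_side !in_tile_shiftE ![_ + d - p]addrAC.
by rewrite ![_ - p]addrC adj_shift.
Qed.

Lemma side_link_shift p t t' :
  side_link t t' -> side_link (tile_shift p t) (tile_shift p t').
Proof.
case=> u [v [d [uvd ut vt]]]; exists (u + p), (v + p), d.
by rewrite tile_side_shiftE !in_tile_shiftE ![_ + p + d - p]addrAC !addrK.
Qed.

Lemma even_link x y : adj x y ->
  even_tile x = even_tile y \/ side_link (even_tile x) (even_tile y).
Proof.
case: x y => x1 x2 [y1 y2]; rewrite /adj /= => xy.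
have [/eqP E|E] := boolP ((2 * (x1 %/ 2)%Z, 2 * (x2 %/ 2)%Z) == (2 * (y1 %/ 2)%Z, 2 * (y2 %/ 2)%Z)).
  by left; rewrite /even_tile /= E.
right; rewrite /side_link /even_tile /tile_side /in_tile /adj /=.
move: E; rewrite xpair_eqE => E.
have [[? ?]|[[? ?]|[[? ?]|[? ?]]]] : (y1 = x1 + 1 /\ y2 = x2) \/ (y1 = x1 - 1 /\ y2 = x2) \/
    (y2 = x2 + 1 /\ y1 = x1) \/ (y2 = x2 - 1 /\ y1 = x1) by lia.
- by exists (x1, 2 * (x2 %/ 2)%Z), (x1, 2 * (x2 %/ 2)%Z + 1), (1, 0); rewrite !inE /=; split; lia.
- by exists (x1, 2 * (x2 %/ 2)%Z), (x1, 2 * (x2 %/ 2)%Z + 1), (-1, 0); rewrite !inE /=; split; lia.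
- by exists (2 * (x1 %/ 2)%Z, x2), (2 * (x1 %/ 2)%Z + 1, x2), (0, 1); rewrite !inE /=; split; lia.
- by exists (2 * (x1 %/ 2)%Z, x2), (2 * (x1 %/ 2)%Z + 1, x2), (0, -1); rewrite !inE /=; split; lia.
Qed.

(** When [w] and [h] have the parity of the offset [p], the grid around a piece is the even grid of
    the region, seen in the coordinates of the piece. *)
Lemma outer_tileE (p z : Z2) (w h : int) : (w %% 2 = p.1 %% 2)%Z -> (h %% 2 = p.2 %% 2)%Z ->
  even_tile z = tile_shift p (outer_tile w h (z - p)).
Proof.
case: p z => p1 p2 [z1 z2] /= wp hp; rewrite /even_tile /tile_shift /outer_tile /=.
by congr (_, _, _) => /=; lia.
Qed.

Lemma zoneP (a : Z2 -> bool) (w h : int) (z : Z2) : zone a w h z ->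
  (w == 2) || (w == 3) -> (h == 2) || (h == 3) -> exists2 x, a (blk x) & nearby 3 z x.
Proof.
case/or4P => az w3 h3; eexists; try exact: az; rewrite /nearby /=; lia.
Qed.

Lemma addZ2 (x y x' y' : int) : (x, y) + (x', y') = (x + x', y + y') :> Z2.
Proof. by []. Qed.

Lemma near_add (u d : Z2) : nearby 16 d 0 -> nearby 16 u (u + d).
Proof. by case: u d => ? ? [? ?]; rewrite /nearby /=; lia. Qed.

Lemma adj_e1 (u : Z2) : adj (u + (1, 0)) u.
Proof. by case: u => ? ?; rewrite /adj /=; lia. Qed.

(** By the last clause the cells of [t] are interior to [s], so each of them has two links in
    [s]. *)
Definition absorbed (t s : seq Z2) : Prop :=
  [/\ {subset t <= s}, forall x y, link t x y -> link s x y &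
    forall z, z \in t -> z != head 0 s /\ z != last 0 s].

Definition grows (V : seq Z2 -> Prop) (r e : int) (s : seq Z2) : Prop :=
  [/\ good_piece s, forall z, nearby (2 * r) z 0 -> z \in s,
    forall z, z \in s -> nearby (2 * r + e + 200) z 0 &
    forall t, V t -> absorbed t s \/ ~ touch 16 t s].

(** * Weaving a region and the pieces inside it into a new piece *)

Section Extension.
Variables (V : seq Z2 -> Prop) (F : Z2 -> Prop) (k : int).
Hypothesis V_sep : forall s t, V s -> V t -> touch 16 s t -> s = t.
Hypothesis F_conn : grid_connected F.
Hypothesis F_coconn : grid_connected (fun b => ~ F b).
Hypothesis F0 : F 0.
Hypothesis F_bound : forall z, F (blk z) -> nearby k z 0.

Variables (ts : seq (seq Z2)) (p : seq Z2 -> Z2) (a : seq Z2 -> Z2 -> bool).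
Hypothesis ts_uniq : uniq ts.
Hypothesis tsV : forall t, t \in ts -> V t.
Hypothesis tsF : forall t x z, t \in ts -> x \in t -> nearby 16 x z -> F (blk z).
Hypothesis ts_walk : forall t, t \in ts -> [/\ uniq t, walk t & t != [::]].
Hypothesis tsE : forall t z, t \in ts -> (z \in t) = a t (blk (z - p t)).
Hypothesis a_conn : forall t, t \in ts -> grid_connected (a t).
Hypothesis a_coconn : forall t, t \in ts -> grid_connected (fun b => ~ a t b).
Hypothesis ts_exit : forall t, t \in ts ->
  [/\ last 0 t = head 0 t + (0, 1), head 0 t + (1, 0) \notin t &
    modz (head 0 t - p t).2 2 = 0].

Let w t : int := 2 + ((p t).1 %% 2)%Z.
Let h t : int := 2 + ((p t).2 %% 2)%Z.

Let w23 t : (w t == 2) || (w t == 3).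
Proof. by rewrite /w; lia. Qed.

Let h23 t : (h t == 2) || (h t == 3).
Proof. by rewrite /h; lia. Qed.

Let Z t z := zone (a t) (w t) (h t) (z - p t).

Let T z := F (blk z) /\ forall t, t \in ts -> z \notin t.

(** [find] selects the zone that contains [z], which is unique by [Z_sep]; outside all zones the
    even grid of the region is used. *)
Let tau z :=
  let i := find (Z^~ z) ts in
  if (i < size ts)%N then let t := nth [::] ts i in
    tile_shift (p t) (collar_tile (a t) (w t) (h t) (z - p t))
  else even_tile z.

Let Z_near t z : t \in ts -> Z t z -> exists2 x, x \in t & nearby 3 z x.
Proof.
move=> tI Zz; have [x ax zx] := zoneP Zz (w23 t) (h23 t).
exists (p t + x); first by rewrite tsE // addrC addKr.
by rewrite -(near_shift _ (- p t)) addKr addrC.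
Qed.

Let sub_Z t z : t \in ts -> z \in t -> Z t z.
Proof.
move=> tI; rewrite tsE // => az; apply: (zone_rect (w23 t) (h23 t) az);
  by rewrite /blk; move: (w23 t) (h23 t) => /=; lia.
Qed.

Let Z_F t z z' : t \in ts -> Z t z -> nearby 10 z z' -> F (blk z').
Proof.
move=> tI /(Z_near tI)[x xt zx] zz'; apply: (tsF tI xt).
by move: zx zz'; rewrite /nearby; lia.
Qed.

(** A zone stays within 3 of its piece, and 3 + 10 + 3 is 16, the separation of the pieces. *)
Let Z_sep t t' z z' : t \in ts -> t' \in ts -> Z t z -> Z t' z' -> nearby 10 z z' -> t = t'.
Proof.
move=> tI t'I /(Z_near tI)[x xt zx] /(Z_near t'I)[x' xt' zx'] zz'.
apply: V_sep; [exact: tsV|exact: tsV|exists x, x'; split=> //].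
by move: zx zx' zz'; rewrite /nearby; lia.
Qed.

Let near_refl z : nearby 10 z z.
Proof. by rewrite /nearby; lia. Qed.

Let tau_collar t z : t \in ts -> Z t z ->
  tau z = tile_shift (p t) (collar_tile (a t) (w t) (h t) (z - p t)).
Proof.
move=> tI Zz; have hZ : has (Z^~ z) ts by apply/hasP; exists t.
rewrite /tau -has_find hZ; have nI : nth [::] ts (find (Z^~ z) ts) \in ts.
  by rewrite mem_nth // -has_find.
by rewrite -(Z_sep tI nI Zz (nth_find [::] hZ) (near_refl z)).
Qed.

Let tau_even z : (forall t, t \in ts -> ~~ Z t z) -> tau z = even_tile z.
Proof.
move=> nZ; rewrite /tau -has_find ifN //.
by apply/hasPn => t /nZ.
Qed.

Let T_collar t z : t \in ts -> T z -> Z t z -> collar (a t) (w t) (h t) (z - p t).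
Proof. by move=> tI [_ /(_ t tI)] nt Zz; rewrite /collar -tsE // nt andbT. Qed.

Let collar_T t z : t \in ts -> collar (a t) (w t) (h t) (z - p t) -> T z.
Proof.
move=> tI /andP[Zz]; rewrite -tsE // => nt; split; first exact: (Z_F tI Zz).
move=> t' t'I; apply: contraNN nt => zt'.
by rewrite (Z_sep tI t'I Zz (sub_Z t'I zt') (near_refl z)).
Qed.

Let Z_cases z : (exists2 t, t \in ts & Z t z) \/ (forall t, t \in ts -> ~~ Z t z).
Proof.
have [/hasP[t tI Zz]|/hasPn H] := boolP (has (Z^~ z) ts); first by left; exists t.
by right=> t /H.
Qed.

Let tau_dims z : T z -> (tau z).2 \in tile_dims.
Proof.
have [[t tI Zz] Tz|nZ _] := Z_cases z; last by rewrite tau_even.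
by rewrite (tau_collar tI Zz) collar_tile_dims.
Qed.

Let tau_in z : T z -> in_tile (tau z) z.
Proof.
have [[t tI Zz] Tz|nZ _] := Z_cases z.
  by rewrite (tau_collar tI Zz) in_tile_shiftE collar_tile_in // T_collar.
by rewrite tau_even // /in_tile /even_tile /=; lia.
Qed.

Let evenE t z : even_tile z = tile_shift (p t) (outer_tile (w t) (h t) (z - p t)).
Proof. by apply: outer_tileE; rewrite /w /h; lia. Qed.

Let tau_eq z z' : T z -> in_tile (tau z) z' -> T z' /\ tau z' = tau z.
Proof.
have [[t tI Zz] Tz|nZ Tz] := Z_cases z.
  rewrite (tau_collar tI Zz) in_tile_shiftE => z'I.
  have [cz' E] := collar_tile_eq (w23 t) (h23 t) (T_collar tI Tz Zz) z'I.
  split; first exact: (collar_T tI).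
  by rewrite (tau_collar tI) ?E //; case/andP: cz'.
rewrite tau_even // => z'I.
have nZ' t : t \in ts -> ~~ Z t z'.
  move=> tI; move: z'I; rewrite (evenE t) in_tile_shiftE => /(outer_tile_zone (a t) (w23 t) (h23 t)).
  by rewrite /Z => ->; exact: nZ.
rewrite tau_even //; move: z'I; rewrite /in_tile /even_tile /= => z'I; split.
  split; last by move=> t tI; apply: contraNN (nZ' t tI); exact: sub_Z.
  case: Tz => Fz _; suff -> : blk z' = blk z by [].
  by rewrite /blk; congr pair; lia.
by congr (_, _, _); lia.
Qed.

Let O z := F (blk z) /\ forall t, t \in ts -> ~ Z t z.

Let O_T z : O z -> T z.
Proof.
by case=> Fz nZ; split=> // t tI; apply/negP => zt; apply: (nZ t tI); exact: sub_Z.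
Qed.

(** The zones are blow-ups of sets of blocks that are connected and have connected complement; they
    are separated from each other and deep inside the region, so they can be removed from it. The
    region itself is a blow-up by 0. *)
Let O_conn : grid_connected O.
Proof.
have shifted (A B : Z2 -> Prop) (q : Z2) : (forall z, A z <-> B (z - q)) ->
    grid_connected B -> grid_connected A.
  move=> AB cB u v Au Av; have uv := cB _ _ ((AB u).1 Au) ((AB v).1 Av).
  rewrite -[u](subrK q) -[v](subrK q).
  apply: (crt_map (f := fun z => z + q)) uv => x y [Bx By xy].
  apply: rt_step; split; try by apply/AB; rewrite addrK.
  by rewrite ![_ + q]addrC adj_shift.
have w7 t : 0 <= w t <= 7 by move: (w23 t); lia.
have h7 t : 0 <= h t <= 7 by move: (h23 t); lia.
have ZE t z : Z t z <-> blow (a t) (w t) (h t) (z - p t).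
  rewrite /Z /zone /blow; split; first by case/or4P; tauto.
  by case=> [|[|[|]]] ->; rewrite ?orbT.
apply: grid_connected_removes => //.
- have c0 : grid_connected (blow F 0 0) by apply: blow_connected.
  apply: grid_connected_ext c0 => z; rewrite /blow !(subr0, addr0) -surjective_pairing; tauto.
- by move=> t tI; apply: (shifted _ (blow (a t) (w t) (h t)) (p t)) (blow_connected _ _ _) => //;
    exact: a_conn.
- move=> t tI; apply: (shifted _ (fun z => ~ blow (a t) (w t) (h t) z) (p t)) (blow_coconnected _ _ _) => //.
    by move=> z; rewrite ZE.
  exact: a_coconn.
- by move=> t z z' tI Zz zz'; apply: (Z_F tI Zz); move: zz'; rewrite /nearby; lia.
- move=> t t' z z' tI t'I tt' Zz zz' Zz'; case/eqP: tt'.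
  by apply: (Z_sep tI t'I Zz Zz'); move: zz'; rewrite /nearby; lia.
Qed.

Let even_O z : O z -> tau z = even_tile z.
Proof. by case=> _ nZ; apply: tau_even => t /nZ/negP. Qed.

(** The square found by [collar_escape] is within 4 of the zone of [t], so it lies in the region and
    in no other zone. *)
Let T_escape z : T z -> exists2 o, O o & clos_refl_trans Z2 (tile_link T tau) z o.
Proof.
move=> Tz; have [[t tI Zz]|nZ] := Z_cases z; last first.
  by exists z; [split=> [|t /nZ/negP //]; case: Tz|exact: rt_refl].
(* The lower left cell of a block of the piece lies in the region, which bounds the height of the
   block. *)
have aB b : a t b -> b.2 <= ((k - (p t).2) %/ 16)%Z + 1.
  move=> ab; have zt : p t + (16 * b.1, 16 * b.2) \in t.
    rewrite tsE // addrC addKr (_ : blk _ = b) //.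
    by rewrite [b in RHS]surjective_pairing /blk /=; congr pair; lia.
  have /F_bound : F (blk (p t + (16 * b.1, 16 * b.2))).
    by apply: (Z_F tI (sub_Z tI zt)).
  by rewrite /nearby /=; lia.
have [z' [o [zz' cz' no so z'o]]] := collar_escape (w23 t) (h23 t) aB (T_collar tI Tz Zz).
have Zz' : Z t (z' + p t) by rewrite /Z addrK; case/andP: cz'.
have near_o : nearby 4 (z' + p t) (o + p t) by rewrite ![_ + p t]addrC near_shift.
have Oo : O (o + p t).
  split; first by apply: (Z_F tI Zz'); move: near_o; rewrite /nearby; lia.
  move=> t' t'I Zo; have E : t = t'.
    by apply: (Z_sep tI t'I Zz' Zo); move: near_o; rewrite /nearby; lia.
  by move: Zo; rewrite -E /Z addrK (negbTE no).
have liftl x y : collar_link (a t) (w t) (h t) x y -> tile_link T tau (x + p t) (y + p t).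
  case=> cx cy sxy; have [Tx Ty] : T (x + p t) /\ T (y + p t).
    by split; apply: (collar_T tI); rewrite addrK.
  split=> //; right; rewrite !(tau_collar tI) ?addrK //; first exact: side_link_shift.
  - by rewrite /Z addrK; case/andP: cy.
  - by rewrite /Z addrK; case/andP: cx.
exists (o + p t) => //; apply: (@rt_trans _ _ _ (z' + p t)).
  rewrite -[z](subrK (p t)); apply: (crt_map (f := fun z => z + p t)) zz' => x y xy.
  by apply: rt_step; exact: liftl.
apply: rt_step; split; [|exact: O_T|right].
  by apply: (collar_T tI); rewrite addrK.
rewrite (tau_collar tI Zz') addrK even_O // (evenE t) addrK.
exact: side_link_shift.
Qed.

Let tile_link_sym x y : tile_link T tau x y -> tile_link T tau y x.
Proof.
case=> Tx Ty xy; split=> //; have [E|E] := pselect (tau x = tau y); first by left.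
case: xy => [//|[u [v [d [uvd ud vd]]]]]; right; exists (u + d), (v + d), (- d).
move: uvd => /and5P[ux vx uv dU /andP[nu nv]].
have out c : in_tile (tau x) c -> ~~ in_tile (tau y) c.
  move=> cx; apply/negP => cy; apply: E.
  by rewrite -(tau_eq Tx cx).2 (tau_eq Ty cy).2.
rewrite /tile_side ud vd ![_ + d]addrC adj_shift uv units_opp //=.
by rewrite ![d + _]addrC !addrK !out.
Qed.

Let O_link x y : O x -> O y -> clos_refl_trans Z2 (tile_link T tau) x y.
Proof.
move=> Ox Oy; apply: (crt_map (f := id)) (O_conn Ox Oy) => u v [Ou Ov uv].
apply: rt_step; split; [exact: O_T|exact: O_T|].
by rewrite !even_O //; exact: even_link.
Qed.

(** The tiles are woven first, starting from a square on the right boundary of the region; then the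
    pieces are inserted at the edges to the right of their ends. *)
Lemma extension_piece : exists s : seq Z2, [/\ good_piece s, forall z, z \in s <-> F (blk z) &
  forall t, t \in ts -> absorbed t s].
Proof.
have [|n [Fn nFn]] := @last_true (fun i => F (i, 0)) k F0.
  move=> n kn Fn; have /F_bound : F (blk (16 * n, 0)).
    by rewrite (_ : blk _ = (n, 0)) // /blk /=; congr pair; lia.
  by rewrite /nearby /=; lia.
(* The two lowest cells in the last column of the block (n, 0) become the ends of the new piece:
   their right neighbours are outside the region, and the height 0 is even, as [piece_at]
   demands. *)
pose z0 : Z2 := (16 * n + 15, 0); pose z1 : Z2 := (16 * n + 15, 1).
have nF0 : ~ F (blk (z0 + (1, 0))).
  by rewrite (_ : blk _ = (n + 1, 0)) // /blk /=; congr pair; lia.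
have nF1 : ~ F (blk (z1 + (1, 0))).
  by rewrite (_ : blk _ = (n + 1, 0)) // /blk /=; congr pair; lia.
have FO z : F (blk z) -> ~ F (blk (z + (1, 0))) -> O z.
  move=> Fz nFz; split=> // t tI Zz; apply: nFz; apply: (Z_F tI Zz).
  by case: (z) => ? ?; rewrite /nearby /=; lia.
have Oz0 : O z0.
  by apply: FO nF0; rewrite (_ : blk _ = (n, 0)) // /blk /=; congr pair; lia.
have Oz1 : O z1.
  by apply: FO nF1; rewrite (_ : blk _ = (n, 0)) // /blk /=; congr pair; lia.
have [L LP] := box_enum k.
have [||||s0 [[us0 ws0 s0E] hs0 ls0 s0side]] :=
  @weave_tiles (fun z => F (blk z)) T tau L _ _ tau_dims tau_in tau_eq
    z0 z0 z1 (1, 0) (O_T Oz0) _ _ nF0 nF1.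
- by move=> z [].
- by move=> z [/F_bound/LP].
- move=> z /T_escape[o Oo zo]; apply: rt_trans (O_link Oz0 Oo) (crt_sym tile_link_sym zo).
- by rewrite even_O // /tile_side /in_tile /adj !inE /even_tile /z0 /z1 /=; lia.
have ts_touch t t' x : t \in ts -> t' \in ts -> x \in t -> x \in t' -> t = t'.
  move=> tI t'I xt xt'; apply: V_sep; [exact: tsV|exact: tsV|exists x, x; split=> //].
  by rewrite /nearby; lia.
pose ex t : Z2 * Z2 := (head 0 t + (1, 0), last 0 t + (1, 0)).
(* The edge to the right of the ends of [t] faces cells of [t], which are in the region but not in
   [T], so the weaving has left it as a link. *)
have exP t : t \in ts -> link s0 (ex t).1 (ex t).2.
  move=> tI; have [_ _ t0] := ts_walk tI; have [lh hn he] := ts_exit tI.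
  have ht := head_in t0; have lt := last_in t0.
  have FN c d : c \in t -> nearby 16 c d -> F (blk d) by move=> ct; exact: tsF tI ct.
  set u := head 0 t in lh hn he ht *.
  have nu1 x : x \in t -> ~ T x by move=> xt [_ /(_ t tI)]; rewrite xt.
  have [x [y uE]] : exists x y : int, u - p t = (x, y).
    by exists (u - p t).1, (u - p t).2; case: (u - p t).
  have hE : u + (1, 0) - p t = (x + 1, y) by rewrite addrAC uE addZ2 addr0.
  have hE' : u + (0, 1) + (1, 0) - p t = (x + 1, y + 1).
    by rewrite addrAC [u + _ - _]addrAC uE !addZ2 !addr0.
  have a1 : a t (blk (x, y)) by rewrite -uE -tsE.
  have a2 : ~~ a t (blk (x + 1, y)) by rewrite -hE -tsE.
  have y2 : modz y 2 = 0 by move: he; rewrite uE.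
  have [cu cE cs] := collar_exit (w23 t) (h23 t) a1 a2 y2.
  have tE : tau (u + (1, 0)) = tile_shift (p t) ((x + 1, y), (w t, 2)).
    by rewrite (tau_collar tI) ?hE ?cE //; rewrite /Z hE; case/andP: cu.
  rewrite /ex /= lh; apply: (s0side (u + (1, 0)) _ _ (-1, 0)).
  - by apply: (collar_T tI); rewrite hE.
  - by rewrite tE tile_side_shiftE hE hE'.
  - by apply: (FN u) => //; rewrite -addrA; exact: near_add.
  - by apply: (FN u) => //; rewrite -!addrA; exact: near_add.
  - by rewrite -addrA (_ : (1, 0) + _ = 0) // addr0; exact: nu1.
  - by rewrite -addrA (_ : (1, 0) + _ = 0) // addr0 -lh; exact: nu1.
have dis t t' : t \in ts -> t' \in ts -> t != t' -> ~~ has (mem t') t.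
  move=> tI t'I; apply: contraNN => /hasP[x xt xt'].
  by apply/eqP; exact: ts_touch xt xt'.
have dis0 t : t \in ts -> ~~ has (mem s0) t.
  move=> tI; apply/hasPn => x xt; apply/negP => /s0E[_ /(_ t tI)].
  by rewrite xt.
have exA t : t \in ts -> [/\ link s0 (ex t).1 (ex t).2, adj (ex t).1 (head 0 t) &
    adj (last 0 t) (ex t).2].
  move=> tI; split; first exact: exP.
    exact: adj_e1.
  by rewrite adjC; exact: adj_e1.
have exN t t' : t \in ts -> t' \in ts -> t != t' ->
    (ex t != ex t') && (ex t != ((ex t').2, (ex t').1)).
  move=> tI t'I tt'; have [_ _ t0] := ts_walk tI; have [_ _ t0'] := ts_walk t'I.
  have ht := head_in t0; have ht' := head_in t0'; have lt' := last_in t0'.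
  apply/andP; split; apply: contraNneq tt' => E; have /= /addIr E1 := congr1 fst E;
    apply/eqP; apply: (ts_touch t t' (head 0 t)) => //; rewrite E1 //.
have [s [[us ws sE] hs ls slink _]] :=
  weave_pieces us0 ws0 ts_uniq ts_walk dis0 dis exA exN.
have sF z : z \in s <-> F (blk z).
  rewrite sE; split=> [[/s0E[] //|[t tI zt]]|Fz].
    by apply: (tsF tI zt); rewrite /nearby; lia.
  have [/hasP[t tI zt]|/hasPn nz] := boolP (has (fun t => z \in t) ts).
    by right; exists t.
  by left; apply/s0E.
exists s; split=> //.
- split=> //; first by apply/negP => /eqP s_nil; move: ((sF 0).2 F0); rewrite s_nil.
  exists 0, (fun b => `[< F b >]); split.
  + by move=> z; rewrite subr0; apply/idP/asboolP => /sF.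
  + by apply: grid_connected_ext F_conn => z; split=> /asboolP.
  + apply: grid_connected_ext F_coconn => z; split=> [nF /asboolP //|nF Fz].
    by apply: nF; apply/asboolP.
  + rewrite hs ls hs0 ls0; split; last by rewrite subr0 mod0z.
      by rewrite /z0 addZ2 addr0 add0r.
    by apply/negP => /sF.
move=> t tI; split.
- by move=> z zt; rewrite sE; right; exists t.
- exact: slink tI.
(* The ends [z0] and [z1] lie in [T], hence in no earlier piece. *)
- move=> z zt; rewrite hs ls hs0 ls0; split; apply: contraTneq zt => ->.
    by have [_ /(_ t tI)] := O_T Oz0.
  by have [_ /(_ t tI)] := O_T Oz1.
Qed.

End Extension.

Lemma extension (V : seq Z2 -> Prop) (r e : int) : 0 <= r -> 0 <= e -> tame e V ->
  exists s, grows V r e s.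
Proof.
move=> r0 e0 tV; have [F [cF cnF F0 FB FV]] := region r0 e0 tV.
have [gV sV _] := tV; pose k := 2 * r + e + 200.
pose Q t := V t /\ forall x z, x \in t -> nearby 16 x z -> F (blk z).
have [L LP] := box_enum k.
have QF t x : Q t -> x \in t -> F (blk x).
  by case=> _ H xt; apply: (H x) => //; rewrite /nearby; lia.
have Qhead t : Q t -> head 0 t \in t by case=> /gV[_ _ t0 _] _; exact: head_in.
have [t Qt|t t' Qt Qt' E|ts [uts tsE]] := @piece_enum L Q.
- by apply/LP/FB/(QF t) => //; exact: Qhead.
- have h1 := Qhead _ Qt; have h2 := Qhead _ Qt'; rewrite -E in h2.
  apply: sV; [by case: Qt|by case: Qt'|exists (head 0 t), (head 0 t)].
  by split=> //; rewrite /nearby; lia.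
have /choice[f fP] : forall t : seq Z2, exists pa : Z2 * (Z2 -> bool),
    t \in ts -> piece_at pa.1 pa.2 t.
  move=> t; have [tI|tI] := boolP (t \in ts); last by exists (0, fun=> true).
  by have /tsE[/gV[_ _ _ [p [a pa]]] _] := tI; exists (p, a).
have F00 : F (blk 0) by apply: F0; rewrite /nearby; lia.
have [s [gs sE sabs]] : exists s : seq Z2, [/\ good_piece s,
    forall z, z \in s <-> F (blk z) & forall t, t \in ts -> absorbed t s].
  apply: (@extension_piece V F k sV cF cnF F00 FB ts (fst \o f) (snd \o f)) => //.
  - by move=> t /tsE[].
  - by move=> t x z /tsE[_]; apply.
  - by move=> t /tsE[/gV[]].
  - by move=> t z /fP[H _ _ _]; exact: H.
  - by move=> t /fP[].
  - by move=> t /fP[].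
  - by move=> t /fP[].
exists s; split=> //.
- by move=> z /F0; apply: (sE z).2.
- by move=> z /sE/FB.
move=> t Vt; have [inF|outF] := FV t Vt; first by left; apply/sabs/tsE.
by right=> -[x [y [xt /sE Fy xy]]]; exact: (outF x y).
Qed.

Local Open Scope classical_set_scope.

(** * Borel markers *)

Section BorelPredicates.
Variable X : topologicalType.
Implicit Types P Q : X -> Prop.

Lemma borel_ext P Q : (forall x, P x <-> Q x) -> borel P -> borel Q.
Proof. by move=> PQ; suff -> : P = Q by []; apply/funext => x; apply/propext. Qed.

Lemma borel_not P : borel P -> borel (fun x => ~ P x).
Proof. by move=> /sigma_algebraCD; rewrite setTD. Qed.

Lemma borel_cst (p : Prop) : borel (fun _ : X => p).
Proof.
have b0 : borel (set0 : set X) by exact: sigma_algebra0.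
have [hp|hp] := pselect p; last by apply: borel_ext b0 => x.
by apply: borel_ext (borel_not b0) => x; split=> // _ [].
Qed.

Lemma borel_ex (T : countType) (P : T -> X -> Prop) :
  (forall t, borel (P t)) -> borel (fun x => exists t, P t x).
Proof.
move=> bP; have := @sigma_algebra_bigcup X setT (@open X)
  (fun n => if unpickle n is Some t then P t else set0) _.
move=> H; apply: borel_ext (H _) => [x|n]; last first.
  by case: unpickle => [t|]; [exact: bP|exact: sigma_algebra0].
split=> [[n _ /=]|[t Pt]]; first by case: unpickle => // t Pt; exists t.
by exists (pickle t) => //=; rewrite pickleK.
Qed.

Lemma borel_all (T : countType) (P : T -> X -> Prop) :
  (forall t, borel (P t)) -> borel (fun x => forall t, P t x).
Proof.
move=> bP; have := borel_not (borel_ex (fun t => borel_not (bP t))).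
apply: borel_ext => x; split=> [H t|H [t]]; last by apply; exact: H.
by apply: contrapT => nP; apply: H; exists t.
Qed.

Lemma borel_or P Q : borel P -> borel Q -> borel (fun x => P x \/ Q x).
Proof.
move=> bP bQ; have : borel (fun x => exists b : bool, (if b then P else Q) x).
  by apply: borel_ex => -[].
by apply: borel_ext => x; split=> [[[]]|[]] ?; [left|right|exists true|exists false].
Qed.

Lemma borel_and P Q : borel P -> borel Q -> borel (fun x => P x /\ Q x).
Proof.
move=> bP bQ; have : borel (fun x => forall b : bool, (if b then P else Q) x).
  by apply: borel_all => -[].
apply: borel_ext => x; split=> [H|[? ?] []//].
by split; [exact: (H true)|exact: (H false)].
Qed.

Lemma borel_imp P Q : borel P -> borel Q -> borel (fun x => P x -> Q x).
Proof.
move=> bP bQ; have := borel_or (borel_not bP) bQ.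
by apply: borel_ext => x; rewrite implyE.
Qed.

End BorelPredicates.

Lemma borel_preimage (X Y : topologicalType) (f : X -> Y) : continuous f -> borel_map f.
Proof.
move=> cf B bB; apply: (bB (fun B => borel (f @^-1` B))); split.
  split; first by rewrite preimage_set0; exact: sigma_algebra0.
    by move=> C bC; rewrite setTD preimage_setC; exact: borel_not.
  by move=> C bC; rewrite preimage_bigcup; exact: sigma_algebra_bigcup.
by move=> C oC; apply: sub_sigma_algebra; apply: open_comp => // x _; exact: cf.
Qed.

Lemma borel_act (X : topologicalType) (act : Z2 -> X -> X) (g : Z2) (B : X -> Prop) :
  borel_action act -> borel B -> borel (fun x => B (act g x)).
Proof.
move=> bact /bact bB; have cg : continuous (fun x : X => (g : discrete_topology Z2, x)).
  move=> x; apply: (@cvg_pair X (discrete_topology Z2) X (nbhs x)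
    (nbhs (g : discrete_topology Z2)) (nbhs x) _ _ _ (fun=> g) id) => //.
  exact: (@cvg_cst (discrete_topology Z2)).
exact: borel_preimage cg _ bB.
Qed.

(** [O (i, j)] is the ball of radius 1/(j + 1) around the point of the dense set numbered i by [f],
    and empty if there is none. Two points are separated once 1/(j + 1) is less than half their
    distance. *)
Lemma borel_separating (R : realType) (X : topologicalType) : polish_space R X ->
  exists O : nat * nat -> X -> Prop, (forall i, borel (O i)) /\
    forall x y, x <> y -> exists i, O i x /\ ~ O i y.
Proof.
case=> -[D /countable_injP[f finj] Dd] [d [[d0 dE dC dT] dtop _]].
have ball_open c (e : R) : open [set y | d c y < e].
  rewrite openE => y /= cy; apply/dtop; exists (e - d c y); first by rewrite subr_gt0.
  move=> z /= yz; apply: le_lt_trans (dT c y z) _.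
  by rewrite -ltrBrDl.
exists (fun i x => exists2 y, D y & f y = i.1 /\ d y x < i.2.+1%:R^-1); split.
  move=> i; apply: sub_sigma_algebra.
  rewrite (_ : (fun _ => _) =
    \bigcup_(y in [set y | D y /\ f y = i.1]) [set x | d y x < i.2.+1%:R^-1]).
    by apply: bigcup_open => y _; exact: ball_open.
  apply/seteqP; split=> x [y]; first by move=> Dy [fy yx]; exists y.
  by move=> [Dy fy] yx; exists y.
move=> x y xy; have dxy : 0 < d x y / 2.
  by rewrite divr_gt0 // lt_neqAle d0 andbT; apply/eqP => /esym/dE.
have [j j_lt] : exists j : nat, j.+1%:R^-1 < d x y / 2.
  have ey : 0 <= (d x y / 2)^-1 by rewrite invr_ge0 ltW.
  exists (Num.bound (d x y / 2)^-1); rewrite invf_plt ?posrE ?ltr0n //.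
  by apply: lt_le_trans (archi_boundP ey) _; rewrite ler_nat.
have [z [xz Dz]] : [set z | d x z < j.+1%:R^-1] `&` D !=set0.
  apply: Dd; last exact: ball_open.
  by exists x; rewrite /= (dE x x).2 // invr_gt0.
exists (f z, j); split; first by exists z => //; rewrite /= dC.
case=> z' Dz' /= [fz' z'y]; have E : z' = z by apply: finj => //; exact/mem_set.
rewrite E in z'y; have := le_lt_trans (dT x z y) (ltrD xz z'y).
by move=> /lt_trans/(_ (ltrD j_lt j_lt)); rewrite -splitr ltxx.
Qed.

(** A countable Borel colouring of the graph that joins [x] to [act g x] for [g] in [L]. A colour
    codes one index i for each [g], such that [O i] contains [x] but not [act g x]; so [x] and
    [act g x] never share a colour. *)
Lemma borel_finer_cover (X : topologicalType) (act : Z2 -> X -> X)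
    (O : nat * nat -> X -> Prop) (L : seq Z2) :
  borel_action act -> (forall i, borel (O i)) ->
  (forall x y, x <> y -> exists i, O i x /\ ~ O i y) ->
  exists A : nat -> X -> Prop, [/\ forall n, borel (A n),
    forall x, (forall g, g \in L -> act g x <> x) -> exists n, A n x &
    forall n x g, g \in L -> A n x -> ~ A n (act g x)].
Proof.
move=> bact bO sepO.
pose C (c : seq (nat * nat)) x := size c = size L /\
  forall p : Z2 * (nat * nat), p \in zip L c -> O p.2 x /\ ~ O p.2 (act p.1 x).
exists (fun n x => exists2 c, unpickle n = Some c & C c x); split.
- move=> n; have : borel (fun x => exists c, unpickle n = Some c /\ C c x).
    apply: borel_ex => c; apply: borel_and (borel_cst _) _.
    rewrite /C; apply: borel_and (borel_cst _) _; apply: borel_all => p.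
    apply: borel_imp (borel_cst _) _; (refine (borel_and _ _)) => //.
    by apply: borel_not; exact: borel_act bact (bO _).
  by apply: borel_ext => x; split=> [[c []]|[c]]; exists c.
- move=> x Lx; suff [c Cc] : exists c, C c x by exists (pickle c), c; rewrite ?pickleK.
  rewrite /C; elim: L Lx {C} => [|g L IH] Lx; first by exists [::].
  have [|c [cL cP]] := IH _.
    by move=> h hL; apply: Lx; rewrite inE hL orbT.
  have [i [Ox nOy]] : exists i, O i x /\ ~ O i (act g x).
    by apply: sepO => /esym; apply: Lx; rewrite mem_head.
  exists (i :: c); split; first by rewrite /= cL.
  by move=> q; rewrite /= inE => /predU1P[->|/cP].
- move=> n x g gL [c cE [cL cP]] [c' c'E [_ cP']].
  move: c'E; rewrite cE => -[cc']; rewrite -{}cc' in cP'.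
  have [i iP] : exists i, (g, i) \in zip L c.
    move: (L) c gL cL {cE cP cP'}; elim=> [//|h L' IH] [//|i c] /= gL [cL].
    move: gL; rewrite inE => /predU1P[->|gL]; first by exists i; rewrite mem_head.
    by have [j jP] := IH c gL cL; exists j; rewrite inE jP orbT.
  by have [_ []] := cP _ iP; have [] := cP' _ iP.
Qed.

(** Pigeonhole: the interval from -10 r to 10 r is covered by 21 intervals of length r, and 442 = 21
    x 21 + 1. *)
Lemma packing (r : int) (h : nat -> Z2) : 1 <= r ->
  (forall i, (i < 442)%N -> nearby (10 * r) (h i) 0) ->
  exists i j, [/\ (i < j)%N, (j < 442)%N & nearby r (h i) (h j)].
Proof.
move=> r1 hr; pose c (x : int) := absz ((x + 10 * r) %/ r)%Z.
have r0 : r != 0 by lia.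
have cP (x : int) : `|x| <= 10 * r -> (c x < 21)%N /\
    (c x)%:Z * r <= x + 10 * r < (c x)%:Z * r + r.
  move=> xr; have q0 : (0 <= ((x + 10 * r) %/ r)%Z) by rewrite divz_ge0; lia.
  have Eq : (c x)%:Z = ((x + 10 * r) %/ r)%Z by rewrite /c gez0_abs.
  have m0 : (0 <= ((x + 10 * r) %% r)%Z) by rewrite modz_ge0.
  have m1 : ((x + 10 * r) %% r)%Z < r by rewrite ltz_pmod; lia.
  have E := divz_eq (x + 10 * r) r; rewrite -Eq in E; split; last by lia.
  rewrite -ltz_nat Eq ltz_divLR; lia.
pose f (i : 'I_442) : 'I_21 * 'I_21 := (inord (c (h i).1), inord (c (h i).2)).
have /injectivePn[i [j ij fij]] : ~~ injectiveb f.
  apply/injectiveP => /leq_card; by rewrite card_prod !card_ord.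
have hb (u : 'I_442) : `|(h u).1| <= 10 * r /\ `|(h u).2| <= 10 * r.
  by have := hr u (ltn_ord u); rewrite /nearby /=; lia.
wlog lij : i j ij fij / (i < j)%N.
  move=> W; case: (ltngtP i j) => [||/val_inj E]; first exact: (W i j).
    by apply: (W j i) => //; rewrite eq_sym.
  by rewrite E eqxx in ij.
exists i, j; split=> //.
have [hi1 hi2] := hb i; have [hj1 hj2] := hb j.
have [[ci1 Ci1] [ci2 Ci2]] := (cP _ hi1, cP _ hi2).
have [[cj1 Cj1] [cj2 Cj2]] := (cP _ hj1, cP _ hj2).
case: fij => /(congr1 val); rewrite /= !inordK // => E1.
move=> /(congr1 val); rewrite /= !inordK // => E2.
by rewrite E1 in Ci1; rewrite E2 in Ci2; rewrite /nearby; lia.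
Qed.

(** * Separated Borel marker sets for a free action *)

Section Markers.
Variables (X : topologicalType) (act : Z2 -> X -> X).
Hypothesis act0 : forall x, act 0 x = x.
Hypothesis actD : forall g h x, act (g + h) x = act g (act h x).
Hypothesis act_free : free_action act.
Hypothesis act_borel : borel_action act.
Variable O : nat * nat -> X -> Prop.
Hypothesis O_borel : forall i, borel (O i).
Hypothesis O_sep : forall x y, x <> y -> exists i, O i x /\ ~ O i y.

(** Greedy choice along a countable Borel colouring: a point of [B] with the current colour is added
    unless a neighbour was added earlier. Points of one colour are never neighbours, so a whole
    colour class is treated at once. *)
Lemma maximal_separated (k : int) (B : X -> Prop) : borel B ->
  exists M : X -> Prop, [/\ borel M, forall x, M x -> B x,
    forall x g, M x -> M (act g x) -> nearby k g 0 -> g = 0 &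
    forall x, B x -> exists g, (nearby k g 0 \/ g = 0) /\ M (act g x)].
Proof.
move=> bB; have [L0 L0P] := box_enum k.
pose L := [seq g <- L0 | nearby k g 0 && (g != 0)].
have LP g : (g \in L) = nearby k g 0 && (g != 0).
  by rewrite mem_filter; case: (boolP (nearby k g 0)) => //= /L0P ->; rewrite andbT.
have LN g : g \in L -> - g \in L.
  rewrite !LP oppr_eq0 => /andP[gk ->]; rewrite andbT.
  by case: g gk => a b; rewrite /nearby /=; lia.
have [A [bA Aex Asep]] := borel_finer_cover L act_borel O_borel O_sep.
pose Ms := fix Ms n x := if n is n'.+1 then Ms n' x \/
    [/\ B x, A n' x & forall g, g \in L -> ~ Ms n' (act g x)] else False.
have bM n : borel (Ms n).
  elim: n => [|n IH]; first exact: borel_cst.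
  (refine (borel_or _ _)) => //.
  have : borel (fun x => B x /\ (A n x /\ forall g, g \in L -> ~ Ms n (act g x))).
    (refine (borel_and _ _)) => //; (refine (borel_and _ _)) => //; apply: borel_all => g.
    by apply: borel_imp (borel_cst _) _; apply: borel_not; exact: borel_act act_borel IH.
  by apply: borel_ext => x; split=> [[? []]|[]].
have Mmono m n x : (m <= n)%N -> Ms m x -> Ms n x.
  move=> /subnK <-; elim: (n - m)%N => [//|i IH] Mx.
  by rewrite addSn; left; exact: IH.
have Msep n x g : g \in L -> Ms n x -> ~ Ms n (act g x).
  elim: n x g => [//|n IH] x g gL /= [Mx|[Bx Ax nM]] [My|[By Ay nM']].
  - exact: IH Mx My.
  - by apply: (nM' (- g)); [exact: LN|rewrite -actD addNr act0].
  - exact: nM My.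
  - exact: Asep Ax Ay.
exists (fun x => exists n, Ms n x); split.
- exact: borel_ex.
- by move=> x [n]; elim: n => [//|n IH] /= [/IH|[]].
- move=> x g [m Mx] [n My] gk; apply/eqP/negPn/negP => g0.
  have gL : g \in L by rewrite LP gk.
  apply: (Msep (maxn m n) x g gL); first exact: Mmono (leq_maxl _ _) Mx.
  exact: Mmono (leq_maxr _ _) My.
move=> x Bx; have [n An] : exists n, A n x.
  by apply: Aex => g; rewrite LP => /andP[_ /eqP g0] /act_free.
have [[g [gL Mg]]|none] := pselect (exists g, g \in L /\ Ms n (act g x)).
  exists g; split; last by exists n.
  by left; move: gL; rewrite LP => /andP[].
exists 0; rewrite act0; split; [by right|exists n.+1; right; split=> // g gL Mg].
by apply: none; exists g.
Qed.

(** Each [M i] is maximal separated among the points that are not r-close to the earlier sets. A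
    point that is r-close to none of the first k has a point of each [M i] within 10 r, and these
    are not r-close to each other. *)
Lemma marker_step (r : int) (k : nat) : 1 <= r ->
  exists M : nat -> X -> Prop, [/\ forall i, borel (M i),
    forall i x g, M i x -> M i (act g x) -> nearby (10 * r) g 0 -> g = 0 &
    forall x, (exists i g, [/\ (i < k)%N, nearby r g 0 & M i (act g x)]) \/
      exists h : nat -> Z2, forall i, (i < k)%N -> nearby (10 * r) (h i) 0 /\
        forall j, (i < j < k)%N -> ~~ nearby r (h i) (h j)].
Proof.
move=> r1; suff : exists M : nat -> X -> Prop, [/\ forall i, borel (M i),
    forall i x g, M i x -> M i (act g x) -> nearby (10 * r) g 0 -> g = 0 &
    forall x, (exists i g, [/\ (i < k)%N, nearby r g 0 & M i (act g x)]) \/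
      exists h : nat -> Z2, forall i, (i < k)%N -> [/\ nearby (10 * r) (h i) 0,
        M i (act (h i) x) & forall j, (i < j < k)%N -> ~~ nearby r (h i) (h j)]].
  case=> M [bM sM cM]; exists M; split=> // x; case: (cM x) => [?|[h hP]]; first by left.
  by right; exists h => i ik; have [] := hP i ik.
elim: k => [|k [M [bM sM cM]]].
  exists (fun _ _ => False); split=> // [i|x]; first exact: borel_cst.
  by right; exists (fun=> 0).
pose B x := ~ exists i g, [/\ (i < k)%N, nearby r g 0 & M i (act g x)].
have bB : borel B.
  apply: borel_not; apply: borel_ex => i; apply: borel_ex => g.
  have : borel (fun x => (i < k)%N /\ (nearby r g 0 /\ M i (act g x))).
    apply: borel_and (borel_cst _) _; apply: borel_and (borel_cst _) _.
    exact: borel_act act_borel (bM i).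
  by apply: borel_ext => x; split=> [[? []]|[]].
have [M1 [bM1 M1B sM1 cM1]] := maximal_separated (10 * r) bB.
exists (fun i => if (i < k)%N then M i else M1); split.
- by move=> i; case: ifP.
- by move=> i x g; case: ifP => _; [exact: sM|exact: sM1].
move=> x; case: (cM x) => [[i [g [ik gr Mg]]]|[h hP]].
  by left; exists i, g; rewrite ik ltnS ltnW.
have [Bx|/contrapT[i [g [ik gr Mg]]]] := pselect (B x); last first.
  by left; exists i, g; rewrite ik ltnS ltnW.
have [g [gk Mg]] := cM1 x Bx.
have {}gk : nearby (10 * r) g 0.
  by case: gk => // ->; rewrite /nearby /=; lia.
right; exists (fun i => if (i < k)%N then h i else g) => i; rewrite ltnS leq_eqVlt.
case/predU1P => [->|ik].
  by rewrite ltnn; split=> // j; lia.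
have [hi Mi hj] := hP i ik; rewrite ik; split=> // j /andP[ij].
rewrite ltnS leq_eqVlt => /predU1P[->|jk]; last by rewrite jk; apply: hj; rewrite ij jk.
rewrite ltnn; apply/negP => hg; apply: (M1B _ Mg); exists i, (h i - g); split=> //.
  by move: hg; case: (h i) (g) => ? ? [? ?]; rewrite /nearby /=; lia.
by rewrite -actD subrK.
Qed.

(** By [packing], for each n one of 442 separated sets comes r_n-close to a given point. Some index
    works for infinitely many n, and the least such index is constant on orbits; using on each orbit
    the sets with that index keeps the separation. *)
Lemma orbit_markers (r : nat -> int) : (forall n, 1 <= r n) ->
  exists M : nat -> X -> Prop, [/\ forall n, borel (M n),
    forall n x g, M n x -> M n (act g x) -> nearby (10 * r n) g 0 -> g = 0 &
    forall x, exists D : nat, forall N, exists n g,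
      [/\ (N <= n)%N, nearby (r n + D%:Z) g 0 & M n (act g x)]].
Proof.
move=> r1.
have /choice[M MP] : forall n, exists M : nat -> X -> Prop, [/\ forall i, borel (M i),
    forall i x g, M i x -> M i (act g x) -> nearby (10 * r n) g 0 -> g = 0 &
    forall x, exists i g, [/\ (i < 442)%N, nearby (r n) g 0 & M i (act g x)]].
  move=> n; have [M [bM sM cM]] := marker_step 442 (r1 n).
  exists M; split=> // x; case: (cM x) => [//|[h hP]].
  have [|i [j [ij j442 hij]]] := packing (h := h) (r1 n).
    by move=> i i442; have [] := hP i i442.
  have [_ /(_ j)] := hP i (ltn_trans ij j442).
  by rewrite ij j442 hij => /(_ isT).
(* The slack [D] makes this property invariant under the action: passing to [act h x] enlarges [D]
   by the size of [h]. *)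
pose inf i x := exists D : nat, forall N, exists n g,
  [/\ (N <= n)%N, nearby (r n + D%:Z) g 0 & M n i (act g x)].
have inf_act i h x : inf i x -> inf i (act h x).
  case=> D HD; exists (D + absz h.1 + absz h.2)%N => N.
  have [n [g [Nn gn Mg]]] := HD N; exists n, (g - h); split=> //.
    by move: gn; case: (g) (h) => ? ? [? ?]; rewrite /nearby /=; lia.
  by rewrite -actD subrK.
pose cls i x := inf i x /\ forall j, (j < i)%N -> ~ inf j x.
have cls_act i h x : cls i x -> cls i (act h x).
  move=> [ix nj]; split; first exact: inf_act.
  move=> j ji /(inf_act _ (- h)); rewrite -actD addNr act0; exact: nj.
have cls_uniq i j x : cls i x -> cls j x -> i = j.
  by move=> [ix ni] [jx nj]; case: (ltngtP i j) => // [/nj|/ni].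
have cls_ex x : exists i, cls i x.
  have [i ix] : exists i, inf i x.
    apply: contrapT => none.
    (* If no index worked infinitely often, then beyond some stage none of the 442 sets would be
       close to [x]. *)
    have bound k : exists N, forall n i g, (N <= n)%N -> (i < k)%N ->
        nearby (r n) g 0 -> ~ M n i (act g x).
      elim: k => [|k [N HN]]; first by exists 0%N.
      have /existsNP[N' HN'] : ~ forall N, exists n g,
          [/\ (N <= n)%N, nearby (r n + 0%:Z) g 0 & M n k (act g x)].
        by move=> H; apply: none; exists k, 0%N.
      exists (maxn N N') => n i g; rewrite geq_max => /andP[Nn N'n].
      rewrite ltnS leq_eqVlt => /predU1P[->|ik] gn Mg; last exact: (HN n i g).
      by apply: HN'; exists n, g; rewrite addr0.
    have [N HN] := bound 442%N; have [_ _ /(_ x)[i [g [i442 gn Mg]]]] := MP N.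
    exact: (HN N i g).
  have ex_inf : exists n, `[< inf n x >] by exists i; apply/asboolP.
  case: (ex_minnP ex_inf) => m /asboolP mx mmin; exists m; split=> // j jm /asboolP/mmin.
  by rewrite leqNgt jm.
have b_inf i : borel (inf i).
  apply: borel_ex => D; apply: borel_all => N; apply: borel_ex => n; apply: borel_ex => g.
  have : borel (fun x => ((N <= n)%N /\ nearby (r n + D%:Z) g 0) /\ M n i (act g x)).
    by apply: borel_and (borel_cst _) _; have [bM _ _] := MP n; exact: borel_act act_borel (bM i).
  by apply: borel_ext => x; split=> [[[]]|[]].
exists (fun n x => exists i, cls i x /\ M n i x); split.
- move=> n; apply: borel_ex => i; have [bM _ _] := MP n; apply: borel_and _ (bM i).
  apply: borel_and (b_inf i) _; apply: borel_all => j.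
  by apply: borel_imp (borel_cst _) _; exact: borel_not.
- move=> n x g [i [ci Mi]] [j [cj Mj]]; have [_ sM _] := MP n.
  by apply: (sM i x) => //; rewrite (cls_uniq _ _ _ (cls_act i g x ci) cj).
- move=> x; have [i ci] := cls_ex x; have [[D HD] _] := ci.
  exists D => N; have [n [g [Nn gn Mg]]] := HD N; exists n, g; split=> //.
  by exists i; split=> //; exact: cls_act.
Qed.
End Markers.

(** * The lining *)

Lemma absorbed_trans s t u : absorbed s t -> absorbed t u -> absorbed s u.
Proof.
move=> [st lst est] [tu ltu etu]; split.
- by move=> z /st/tu.
- by move=> x y /lst/ltu.
- by move=> z /st/etu.
Qed.

Lemma touch_shift k c s t : touch k (shift c s) (shift c t) <-> touch k s t.
Proof.
split=> [[x [y]]|[x [y]]] [xs yt xy].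
  exists (x - c), (y - c); rewrite -!mem_shiftE -(near_shift _ c).
  by rewrite ![c + (_ - c)]addrC !subrK.
by exists (c + x), (c + y); rewrite !mem_shift near_shift.
Qed.

Lemma shift_shift c d s : shift c (shift d s) = shift (c + d) s.
Proof. by rewrite /shift -map_comp; apply: eq_map => z /=; rewrite addrA. Qed.

Lemma shift0 s : shift 0 s = s.
Proof. by rewrite /shift -[RHS]map_id; apply: eq_map => z; rewrite add0r. Qed.

Lemma head_shift c s : s != [::] -> head 0 (shift c s) = c + head 0 s.
Proof. by case: s. Qed.

Lemma last_shift c s : s != [::] -> last 0 (shift c s) = c + last 0 s.
Proof. by case/lastP: s => // s x _; rewrite /shift map_rcons !last_rcons. Qed.

Lemma good_piece_shift c s : good_piece s -> good_piece (shift c s).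
Proof.
case=> us ws s0 [p [a [sE ca na [hl hn hp]]]]; split.
- by rewrite map_inj_uniq //; exact: addrI.
- by rewrite walk_shift.
- by case: (s) s0.
exists (c + p), a; split=> //.
  by move=> z; rewrite mem_shiftE sE opprD addrA.
rewrite head_shift // last_shift // hl addrA; split=> //.
  by rewrite -addrA mem_shift.
by rewrite opprD addrA [c + _]addrC addrK.
Qed.

Lemma absorbed_shift c s t : s != [::] -> t != [::] -> absorbed s t ->
  absorbed (shift c s) (shift c t).
Proof.
move=> s0 t0 [st lst est]; split.
- by move=> z; rewrite !mem_shiftE; exact: st.
- move=> x y; rewrite -[x](subrK c) -[y](subrK c) ![_ + c]addrC !link_shift.
  exact: lst.
- move=> z; rewrite mem_shiftE => /est[zh zl].
  rewrite head_shift // last_shift // -[z](subrK c) addrC.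
  by rewrite !(inj_eq (@addrI _ _)).
Qed.

Definition new_piece (V : seq Z2 -> Prop) (r e : int) (m : Z2) (s : seq Z2) : Prop :=
  [/\ good_piece s, forall z, nearby (2 * r) z m -> z \in s,
    forall z, z \in s -> nearby (2 * r + e + 200) z m &
    forall t, V t -> absorbed t s \/ ~ touch 16 t s].

(** New pieces at different markers are more than e + 128 apart, as 2 (2 r + e + 200) + e + 128 is
    at most 10 r. A chain of old pieces has diameter at most e and leaves gaps of at most 64 at its
    ends, so it cannot join two new ones. An old piece touched by a new one is dropped, being
    absorbed. *)
Lemma tame_step (V : seq Z2 -> Prop) (r e : int) (N : Z2 -> seq Z2 -> Prop) :
  0 <= e -> r = e + 1000 -> tame e V ->
  (forall m s, N m s -> new_piece V r e m s) ->
  (forall m m' s s', N m s -> N m' s' -> nearby (10 * r) m m' -> m = m' /\ s = s') ->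
  tame (2 * (2 * r + e + 200 + 64 + e)) (fun s =>
    (V s /\ forall m t, N m t -> ~ touch 16 s t) \/ exists m, N m s).
Proof.
move=> e0 rE [gV sV eV] NP Nsep; set V' := fun s => _; set rho := 2 * r + e + 200.
have Nfar m m' s s' z z' : N m s -> N m' s' -> z \in s -> z' \in s' ->
    nearby (e + 128) z z' -> m = m' /\ s = s'.
  move=> Nm Nm' zs zs' zz'; apply: (Nsep _ _ _ _ Nm Nm').
  have [_ _ /(_ z zs) H _] := NP _ _ Nm; have [_ _ /(_ z' zs') H' _] := NP _ _ Nm'.
  by move: H H' zz'; rewrite /nearby rE; lia.
split.
- by move=> s [[/gV]//|[m /NP[]]].
- move=> s t [[Vs sN]|[m Nm]] [[Vt tN]|[m' Nm']] st.
  + exact: sV.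
  + by case: (sN _ _ Nm').
  + by case: (tN _ _ Nm); exact: touch_sym.
  + case: st => x [y [xs yt xy]]; apply: (Nfar _ _ _ _ _ _ Nm Nm' xs yt _).2.
    by move: xy; rewrite /nearby; lia.
move=> s t Vs st.
(* A chain of kept and new pieces meets at most one new piece. *)
pose P t := (V s /\ chain V s t /\ V t) \/
  exists m T, [/\ N m T, forall x, x \in s -> nearby (rho + 64 + e) x m &
    t = T \/ exists u, [/\ V u, touch 64 u T & chain V u t /\ V t]].
have Nnear m T z : N m T -> z \in T -> nearby rho z m.
  by move=> /NP[_ _ H _] /H.
suff : P t.
  case=> [[Vs0 [ct Vt]] x y xs yt|[m [T [Nm sm tT]]] x y xs yt].
    by have := eV _ _ Vs0 ct x y xs yt; rewrite /nearby; lia.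
  have xm := sm x xs; have ym : nearby (rho + 64 + e) y m.
    case: tT => [tT|[u [Vu [u0 [T0 [u0u T0T uT]]] [ut Vt]]]].
      by rewrite tT in yt; have := Nnear _ _ _ Nm yt; rewrite /nearby; lia.
    have := eV _ _ Vu ut _ _ u0u yt; have := Nnear _ _ _ Nm T0T; move: uT.
    by rewrite /nearby; lia.
  by move: xm ym; rewrite /nearby /rho; lia.
apply: (crt_inv (P := P) _ st); last first.
  case: Vs => [[Vs0 _]|[m Nm]]; first by left; split=> //; split=> //; exact: rt_refl.
  right; exists m, s; split=> //; last by left.
  by move=> x xs; have := Nnear _ _ _ Nm xs; rewrite /nearby; lia.
move=> {st}{}t t' [_ Vt' tt']; case: Vt' => [[Vt' _]|[m' Nm']].
  have step u : V u -> chain V u t -> V t -> chain V u t'.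
    by move=> Vu ut Vt; apply: rt_trans ut (rt_step _ _ _ _ _).
  case=> [[Vs0 [ct Vt]]|[m [T [Nm sm tT]]]].
    by left; split=> //; split=> //; exact: step.
  right; exists m, T; split=> //; right; case: tT => [tT|[u [Vu uT [ut Vt]]]].
    exists t'; split=> //; first by apply: touch_sym; rewrite -tT.
    by split=> //; exact: rt_refl.
  by exists u; split=> //; split=> //; exact: step.
case: tt' => x0 [y0 [x0t y0t' xy0]].
case=> [[Vs0 [ct Vt]]|[m [T [Nm sm tT]]]]; right.
  exists m', t'; split=> //; last by left.
  move=> x xs; have := eV _ _ Vs0 ct _ _ xs x0t; have := Nnear _ _ _ Nm' y0t'.
  by move: xy0; rewrite /nearby; lia.
have [mm' TT'] : m = m' /\ T = t'.
  case: tT => [tT|[u [Vu [u0 [T0 [u0u T0T uT]]] [ut Vt]]]].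
    rewrite tT in x0t; apply: Nfar Nm Nm' x0t y0t' _.
    by move: xy0; rewrite /nearby; lia.
  apply: Nfar Nm Nm' T0T y0t' _.
  by have := eV _ _ Vu ut _ _ u0u x0t; move: uT xy0; rewrite /nearby; lia.
by exists m, T; split=> //; left.
Qed.

Lemma steps_next (T : eqType) (s : seq T) x v w : uniq s ->
  (x, v) \in steps s -> (x, w) \in steps s -> v = w.
Proof.
move=> us; suff H u : (x, u) \in steps s -> u = nth x s (index x s).+1.
  by move=> /H -> /H ->.
case/stepsP=> p [q sE]; move: us; rewrite sE cat_uniq /= => /and3P[_ H _].
have xp : x \notin p by case/norP: H.
by rewrite index_cat (negbTE xp) /= eqxx addn0 nth_cat ltnNge leqnSn subSn // subnn.
Qed.

Lemma steps_prev (T : eqType) (s : seq T) x v w : uniq s ->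
  (v, x) \in steps s -> (w, x) \in steps s -> v = w.
Proof.
by move=> us; rewrite -!(steps_rev s); apply: steps_next; rewrite rev_uniq.
Qed.

Lemma interior_links (T : eqType) (x0 : T) (s : seq T) x : uniq s -> x \in s ->
  x != head x0 s -> x != last x0 s ->
  exists a b, a != b /\ forall v, link s x v <-> v = a \/ v = b.
Proof.
move=> us xs xh xl; case/splitPr: xs us xh xl => s1 s2.
case/lastP: s1 => [|s1 a]; first by rewrite /= eqxx.
case: s2 => [|b s2]; first by rewrite last_cat eqxx.
move=> us _ _; exists a, b.
have sb : (x, b) \in steps (rcons s1 a ++ [:: x, b & s2]).
  by apply/stepsP; exists (rcons s1 a), s2.
have sa : (a, x) \in steps (rcons s1 a ++ [:: x, b & s2]).
  by apply/stepsP; exists s1, (b :: s2); rewrite cat_rcons.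
split.
  move: us; rewrite cat_uniq /= => /and3P[_ /norP[_ /norP[+ _]] _].
  by apply: contraNneq => <-; rewrite mem_rcons mem_head.
move=> v; rewrite /link; split; last by case=> ->; rewrite ?sa ?sb ?orbT.
by case/orP => [/(steps_next us sb)|/(steps_prev us sa)] ->; [right|left].
Qed.

Lemma link_conn (T : eqType) (s : seq T) x y : x \in s -> y \in s ->
  clos_refl_trans T (fun u v => link s u v) x y.
Proof.
have hd : forall (s : seq T) z x, x \in z :: s ->
    clos_refl_trans T (fun u v => link (z :: s) u v) z x.
  elim=> [|z' s' IH] z x'; first by rewrite inE => /eqP ->; exact: rt_refl.
  rewrite inE => /predU1P[->|xs]; first exact: rt_refl.
  apply: (@rt_trans _ _ _ z'); first by apply: rt_step; rewrite /link /steps /= mem_head.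
  apply: (crt_map (f := id)) (IH _ _ xs) => u v uv; apply: rt_step.
  by move: uv; rewrite /link /steps /= !inE => /orP[] ->; rewrite ?orbT.
case: s => // z s xs ys; apply: rt_trans (hd _ _ _ ys); apply: crt_sym (hd _ _ _ xs).
by move=> u v; rewrite linkC.
Qed.

(** * The pieces along the orbits and the graph they form *)

Section Lining.
Variables (X : topologicalType) (act : Z2 -> X -> X).
Hypothesis act0 : forall x, act 0 x = x.
Hypothesis actD : forall g h x, act (g + h) x = act g (act h x).
Hypothesis act_free : free_action act.
Hypothesis act_borel : borel_action act.

(** [err n] bounds the diameter of the clusters after n stages; the recursion is the bound of
    [tame_step] with r = e + 1000. *)
Fixpoint err (n : nat) : int := if n is n'.+1 then
  2 * (2 * (err n' + 1000) + err n' + 200 + 64 + err n') else 0.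

Definition radius (n : nat) : int := err n + 1000.

Variable M : nat -> X -> Prop.
Hypothesis M_borel : forall n, borel (M n).
Hypothesis M_sep : forall n x g, M n x -> M n (act g x) ->
  nearby (10 * radius n) g 0 -> g = 0.
Hypothesis M_cover : forall x, exists D : nat, forall N, exists n g,
  [/\ (N <= n)%N, nearby (radius n + D%:Z) g 0 & M n (act g x)].

(** For fixed [r] and [e] the first solution in the enumeration depends on [V] alone, so the choice
    is Borel and the same from every base point of the orbit. *)
Definition first_grown (V : seq Z2 -> Prop) (r e : int) (s : seq Z2) : Prop :=
  grows V r e s /\ forall t, (pickle t < pickle s)%N -> ~ grows V r e t.

(* [pieces n x] are the current pieces after n steps, in the coordinates of the
   orbit of x centered at x. *)
Fixpoint pieces (n : nat) (x : X) (s : seq Z2) : Prop :=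
  if n is n'.+1 then
    (pieces n' x s /\ forall m t, M n' (act m x) ->
      first_grown (pieces n' (act m x)) (radius n') (err n') t ->
      ~ touch 16 s (shift m t)) \/
    exists m t, [/\ M n' (act m x),
      first_grown (pieces n' (act m x)) (radius n') (err n') t & s = shift m t]
  else False.

(** A change of base point within the orbit only translates the pieces, since each new piece is
    defined from its marker. *)
Lemma pieces_act n g x s : pieces n (act g x) s -> pieces n x (shift g s).
Proof.
elim: n g x s => [//|n IH] g x s /= [[Ps nt]|[m [t [Mm ft sE]]]]; [left|right].
  split; first exact: IH.
  move=> m t Mm ft st; have E : act (m - g) (act g x) = act m x by rewrite -actD subrK.
  apply: (nt (m - g) t); rewrite ?E //.
  by apply/(touch_shift _ g); rewrite shift_shift [g + _]addrC subrK.
by exists (m + g), t; rewrite actD; split=> //; rewrite sE shift_shift addrC.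
Qed.

Lemma borel_grows (V : X -> seq Z2 -> Prop) r e s : (forall t, borel (V ^~ t)) ->
  borel (fun x => grows (V x) r e s).
Proof.
move=> bV; have : borel (fun x => ((good_piece s /\ forall z, nearby (2 * r) z 0 -> z \in s) /\
    forall z, z \in s -> nearby (2 * r + e + 200) z 0) /\
    forall t, V x t -> absorbed t s \/ ~ touch 16 t s).
  apply: borel_and (borel_cst _) _; apply: borel_all => t.
  exact: borel_imp (bV t) (borel_cst _).
by apply: borel_ext => x; split=> [[[[]]]|[]].
Qed.

Lemma borel_first_grown (V : X -> seq Z2 -> Prop) r e s : (forall t, borel (V ^~ t)) ->
  borel (fun x => first_grown (V x) r e s).
Proof.
move=> bV; apply: borel_and (borel_grows r e s bV) _; apply: borel_all => t.
by apply: borel_imp (borel_cst _) _; apply: borel_not; exact: borel_grows.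
Qed.

Lemma borel_pieces n s : borel (fun x => pieces n x s).
Proof.
elim: n s => [|n IH] s /=; first exact: borel_cst.
have bM m : borel (fun x => M n (act m x)) by exact: borel_act act_borel (M_borel n).
have bF m t : borel (fun x =>
    first_grown (pieces n (act m x)) (radius n) (err n) t).
  have bF0 : borel (fun x => first_grown (pieces n x) (radius n) (err n) t).
    exact: borel_first_grown.
  exact: borel_act act_borel bF0.
apply: borel_or.
  apply: borel_and (IH s) _; apply: borel_all => m; apply: borel_all => t.
  by apply: borel_imp (bM m) _; apply: borel_imp (bF m t) (borel_cst _).
apply: borel_ex => m; apply: borel_ex => t.
have : borel (fun x => M n (act m x) /\
    (first_grown (pieces n (act m x)) (radius n) (err n) t /\ s = shift m t)).
  by apply: borel_and (bM m) _; apply: borel_and (bF m t) (borel_cst _).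
by apply: borel_ext => x; split=> [[? []]|[]].
Qed.

Definition new_at n x m s : Prop := exists t, [/\ M n (act m x),
  first_grown (pieces n (act m x)) (radius n) (err n) t & s = shift m t].

Lemma piecesS n x s : pieces n.+1 x s <->
  (pieces n x s /\ forall m t, new_at n x m t -> ~ touch 16 s t) \/
  exists m, new_at n x m s.
Proof.
split=> /=.
  case=> [[Ps H]|[m [t Ht]]]; last by right; exists m, t.
  by left; split=> // m _ [t [Mm ft ->]]; exact: H.
case=> [[Ps H]|[m [t Ht]]]; last by right; exists m, t.
by left; split=> // m t Mm ft; apply: (H m); exists t.
Qed.

Lemma err_ge0 n : 0 <= err n.
Proof. by elim: n => //= n IH; lia. Qed.

Lemma radius_ge n : n%:Z <= radius n.
Proof.
rewrite /radius; elim: n => [//|n IH] /=; have := err_ge0 n; lia.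
Qed.

Lemma new_at_piece n x m s : new_at n x m s ->
  new_piece (pieces n x) (radius n) (err n) m s.
Proof.
case=> t [Mm [[gt tball tbound tV] _] ->]; have [_ _ t0 _] := gt; split.
- exact: good_piece_shift.
- move=> z zm; rewrite mem_shiftE; apply: tball.
  by move: zm; case: (z) (m) => ? ? [? ?]; rewrite /nearby /=; lia.
- move=> z; rewrite mem_shiftE => /tbound.
  by case: (z) (m) => ? ? [? ?]; rewrite /nearby /=; lia.
move=> u Pu; have {}Pu : pieces n (act m x) (shift (- m) u).
  by apply: pieces_act; rewrite -actD addNr act0.
have uE : u = shift m (shift (- m) u) by rewrite shift_shift addrN shift0.
have [uN|u0] := boolP (shift (- m) u == [::]).
  by right=> -[a [b []]]; rewrite uE (eqP uN).
have [ab|nt] := tV _ Pu; first by left; rewrite uE; exact: absorbed_shift.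
by right; rewrite uE => /touch_shift.
Qed.

Lemma new_at_uniq n x m m' s s' : new_at n x m s -> new_at n x m' s' ->
  nearby (10 * radius n) m m' -> m = m' /\ s = s'.
Proof.
move=> [t [Mm [gt tmin] ->]] [t' [Mm' [gt' tmin'] ->]] mm'.
have E : m = m'.
  apply/eqP; rewrite -subr_eq0; apply/eqP; apply: (M_sep (x := act m' x) Mm').
    by rewrite -actD subrK.
  by move: mm'; case: (m) (m') => ? ? [? ?]; rewrite /nearby /=; lia.
split=> //; subst m'; congr shift; apply: (pcan_inj pickleK).
have [lt_p|lt_p|//] := ltngtP (pickle t) (pickle t').
  by have := tmin' _ lt_p gt.
by have := tmin _ lt_p gt'.
Qed.

Lemma tame_pieces n x : tame (err n) (pieces n x).
Proof.
elim: n => [|n IH]; first by split.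
have := tame_step (N := new_at n x) (err_ge0 n) (erefl _) IH
  (@new_at_piece n x) (@new_at_uniq n x).
rewrite -/(radius n) => -[gS sS cS].
have PS := @piecesS n x; split.
- by move=> s /PS; exact: gS.
- by move=> s t /PS ? /PS ?; exact: sS.
- move=> s t /PS Ps st; apply: cS => //.
  by apply: (crt_map (f := id)) st => u v [/PS ? /PS ? ?]; apply: rt_step.
Qed.

Lemma new_at_ex n x m : M n (act m x) -> exists s, new_at n x m s.
Proof.
move=> Mm; have r0 : 0 <= radius n by have := err_ge0 n; rewrite /radius; lia.
have [s0 gs0] := extension r0 (err_ge0 n) (tame_pieces n (act m x)).
pose G i := `[< exists s, pickle s = i /\
  grows (pieces n (act m x)) (radius n) (err n) s >].
have exG : exists i, G i by exists (pickle s0); apply/asboolP; exists s0.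
case: (ex_minnP exG) => i /asboolP[t [ti gt]] imin.
exists (shift m t), t; split=> //; split=> // u.
rewrite ti => ui gu; have /imin : G (pickle u) by apply/asboolP; exists u.
by rewrite leqNgt ui.
Qed.

(** A new piece that touches an old one absorbs it; an old piece touched by none is kept. *)
Lemma pieces_mono m n x s : (n <= m)%N -> pieces n x s ->
  exists2 t, pieces m x t & t = s \/ absorbed s t.
Proof.
move=> /subnK <-; elim: (m - n)%N => [|k IH] Ps; first by exists s => //; left.
have [t Pt st] := IH Ps; rewrite addSn.
have [[c [u [nu tu]]]|none] := pselect (exists c u, new_at (k + n) x c u /\ touch 16 t u).
  have [_ _ _ /(_ t Pt)[tau|//]] := new_at_piece nu.
  exists u; first by apply/piecesS; right; exists c.
  by right; case: st => [<- //|/absorbed_trans]; apply.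
exists t => //; apply/piecesS; left; split=> // c u nu tu.
by apply: none; exists c, u.
Qed.

(** The marker is within [radius n + D] of 0. Once n is at least D plus the size of [g], so is
    [radius n], and the square of half-side [2 * radius n] around the marker contains both 0 and
    [g]. *)
Lemma pieces_cover x g N : exists n m s,
  [/\ (N <= n)%N, new_at n x m s, 0 \in s & g \in s].
Proof.
have [D HD] := M_cover x; pose N' := (N + D + absz g.1 + absz g.2)%N.
have [n [m [N'n mn Mm]]] := HD N'; have [s ns] := new_at_ex Mm.
have rn := radius_ge n; have [_ sball _ _] := new_at_piece ns.
exists n, m, s; split=> //; first by move: N'n; rewrite /N'; lia.
  by apply: sball; move: mn N'n rn; rewrite /nearby /N' /=; lia.
by apply: sball; move: mn N'n rn; rewrite /nearby /N' /=; lia.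
Qed.

Lemma nearby_refl (k : int) z : 0 <= k -> nearby k z z.
Proof. by rewrite /nearby; lia. Qed.

Lemma touch_mem s t z : z \in s -> z \in t -> touch 16 s t.
Proof. by move=> zs zt; exists z, z; split=> //; exact: nearby_refl. Qed.

(** The origin is covered at some stage and again at a later one; the later piece absorbs what the
    earlier one has become, which makes 0 an interior cell. *)
Lemma pieces_interior x : exists n s,
  [/\ pieces n x s, 0 \in s, 0 != head 0 s & 0 != last 0 s].
Proof.
have [n [m [s [_ ns s0 _]]]] := pieces_cover x 0 0.
have Ps : pieces n.+1 x s by apply/piecesS; right; exists m.
have [n' [m' [s' [nn' ns' s'0 _]]]] := pieces_cover x 0 n.+1.
have [t Pt st] := pieces_mono nn' Ps.
have t0 : 0 \in t by case: st => [->|[/(_ _ s0)]].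
have [_ _ _ /(_ t Pt)[[_ _ /(_ _ t0)[hs ls]]|nt]] := new_at_piece ns'; last first.
  by case: nt; exact: touch_mem t0 s'0.
by exists n'.+1, s'; split=> //; apply/piecesS; right; exists m'.
Qed.

(** A link at any stage counts, since links survive when pieces are absorbed. *)
Definition step_edge (x : X) (v : Z2) : Prop :=
  exists n s, pieces n x s /\ link s 0 v.

Definition lining_graph : graph X :=
  Graph setT (fun x y => exists2 v, step_edge x v & y = act v x).

Lemma act_inj u v x : act u x = act v x -> u = v.
Proof.
move=> E; apply/eqP; rewrite -subr_eq0 addrC; apply/eqP; apply: (act_free (x := x)).
by rewrite actD E -actD addNr act0.
Qed.

Lemma step_edge_link n x s u v : pieces n x s -> link s u v ->
  edge lining_graph (act u x) (act v x).
Proof.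
move=> Ps uv; exists (v - u); last by rewrite -actD subrK.
exists n, (shift (- u) s); split.
  by apply: pieces_act; rewrite -actD addNr act0.
by rewrite -(addNr u) [v - u]addrC link_shift.
Qed.

Lemma edge_sym x y : edge lining_graph x y -> edge lining_graph y x.
Proof.
case=> v [n [s [Ps sv]]] ->; rewrite -[x in edge _ _ x]act0.
by apply: (step_edge_link Ps); rewrite linkC.
Qed.

Lemma edge_schreier x y : edge lining_graph x y -> schreier_edge act x y.
Proof.
case=> v [n [s [Ps sv]]] yE; exists v => //.
have [/(_ _ Ps)[_ ws _ _] _ _] := tame_pieces n x.
have : adj 0 v.
  by case/orP: sv => /(allP ws) //=; rewrite adjC.
case: v {sv yE} => a b; rewrite /adj /std_gen /= => ab.
have [[? ?]|[[? ?]|[[? ?]|[? ?]]]] : (a = 1 /\ b = 0) \/ (a = -1 /\ b = 0) \/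
  (a = 0 /\ b = 1) \/ (a = 0 /\ b = -1) by lia.
all: subst a b; rewrite /e1 /e2.
- by left; left; left.
- by left; left; right.
- by left; right.
- by right.
Qed.

(** A piece in which 0 is interior provides two edges. An edge from another stage lies in a piece
    that contains 0; at a common later stage both have grown into the same piece, where 0 has
    exactly two links. *)
Lemma edge_two x : exists a b, a != b /\
  forall y, edge lining_graph x y <-> y = act a x \/ y = act b x.
Proof.
have [n [s [Ps s0 hs ls]]] := pieces_interior x.
have us m t : pieces m x t -> uniq t.
  by move=> Pt; have [/(_ _ Pt)[]] := tame_pieces m x.
have [a [b [ab abP]]] := interior_links (us _ _ Ps) s0 hs ls.
exists a, b; split=> // y; split; last first.
  by case=> ->; [exists a|exists b] => //; exists n, s; split=> //; apply/abP; [left|right].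
case=> v [n' [s' [Ps' s'v]]] ->.
have [t Pt st] := pieces_mono (leq_maxl n n') Ps.
have [t' Pt' st'] := pieces_mono (leq_maxr n n') Ps'.
have t0 : [/\ 0 \in t, 0 != head 0 t & 0 != last 0 t].
  by case: st => [->|[st _ /(_ _ s0)[? ?]]]; split=> //; exact: st.
have t'v : link t' 0 v by case: st' => [->|[_ H _]]; last exact: H.
have /andP[t'0 _] := link_mem t'v.
have E : t = t'.
  have [_ + _] := tame_pieces (maxn n n') x; apply=> //.
  by case: t0 => t0 _ _; exact: touch_mem t0 t'0.
have [t0' th tl] := t0; have [c [d [cd cdP]]] := interior_links (us _ _ Pt) t0' th tl.
have st_link w : link s 0 w -> link t 0 w by case: st => [->|[_ H _]] //; exact: H.
have /cdP va : link t 0 v by rewrite E.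
have /cdP ac : link t 0 a by apply/st_link/abP; left.
have /cdP bc : link t 0 b by apply/st_link/abP; right.
suff [->|->] : v = a \/ v = b by [left|right].
case: va ac bc => -> [aE|aE] [bE|bE]; rewrite ?aE ?bE; try by [left|right].
  by rewrite aE bE eqxx in ab.
by rewrite aE bE eqxx in ab.
Qed.

Lemma lining_graph_line_section : line_section act lining_graph.
Proof.
split; first by split=> //; [exact: edge_sym|exact: edge_schreier].
move=> x _; have [a [b [ab abP]]] := edge_two x.
have -> : [set y | edge lining_graph x y] = [set act a x; act b x].
  by apply/seteqP; split=> y /abP.
apply/eq_cardSP; exists (act a x); first by left.
have -> : [set act a x; act b x] `\ act a x = [set act b x]; last exact: card_set1.
apply/seteqP; split=> [y [[->|->//] []]|y ->] //; split; first by right.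
by move=> /act_inj E; rewrite E eqxx in ab.
Qed.

Lemma lining_graph_lining : lining act lining_graph.
Proof.
split=> //; split; first exact: lining_graph_line_section.
move=> x; exists x => //; rewrite setTI; apply/seteqP; split=> y.
  (* Some piece contains both 0 and [g], and its path joins [x] to [act g x]. *)
  case=> g _ <-; have [n [m [s [_ ns s0 sg]]]] := pieces_cover x g 0.
  have Ps : pieces n.+1 x s by apply/piecesS; right; exists m.
  rewrite /component /= -{1}[x]act0.
  apply: (crt_map (f := act^~ x)) (link_conn s0 sg) => u v uv.
  by apply: rt_step; exact: step_edge_link Ps uv.
rewrite /component /= => xy.
apply: (crt_inv (P := Defs.orbit act x) _ xy); last by exists 0.
by move=> u _ [v _ ->] [g _ <-]; exists (v + g) => //; rewrite actD.
Qed.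

Lemma borel_lining_graph : borel_line_section act lining_graph.
Proof.
split; first exact: lining_graph_line_section.
move=> e _; have : borel (fun x => exists n s, pieces n x s /\ link s 0 e).
  apply: borel_ex => n; apply: borel_ex => s.
  by apply: borel_and (borel_pieces n s) (borel_cst _).
apply: borel_ext => x; split=> [H|[v [n [s [Ps sv]]] /act_inj ->]]; last by exists n, s.
by exists e.
Qed.

End Lining.

Theorem theorem1p3 (R : realType) (X : topologicalType) (act : Z2 -> X -> X) :
  polish_space R X ->
  is_action act -> free_action act -> borel_action act ->
  exists G : graph X, lining act G /\ borel_line_section act G.
Proof.
move=> pX [act0 actD] act_free act_borel; have [O [bO sO]] := borel_separating pX.
have r1 n : 1 <= radius n by have := err_ge0 n; rewrite /radius; lia.
have [M [bM sM cM]] := orbit_markers act0 actD act_free act_borel bO sO r1.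
exists (lining_graph act M); split.
  exact (lining_graph_lining act0 actD act_free sM cM).
exact (borel_lining_graph act0 actD act_free act_borel bM sM cM).
Qed.
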